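(* Let $A>0$ be fixed. The capacity $C=C(\nu)$ of an AWGN channel with an amplitude constraint of $A$ and with noise power $\nu>0$ satisfies the following: 1. As $\nu\to0$, $$C=\log 2A-\frac12\log 2\pi e\nu+O(\nu^{1/3}).$$ 2. As $\nu\to\infty$, $$C=\frac{\alpha^2}{2}-\frac{\alpha^4}{4}+\frac{\alpha^6}{6}-\frac{5\alpha^8}{24}+O(\alpha^{10}),\qquad\text{where }\alpha=A/\sqrt\nu .$$
   Context: All logarithms are natural and rates are in nats. AWGN channel with noise power $\nu$: input $X_i$, output $Y_i=X_i+Z_i$, where $Z_1,Z_2,\dots$ are i.i.d. $\mathcal N(0,\nu)$ independent of the input. Amplitude constraint $A$: every codeword $(x_1,\dots,x_n)$ satisfies $|x_i|\le A$ for all $i$. A code of block length $n$ and rate $R$ consists of a message set $\{1,\dots,\lfloor e^{nR}\rfloor\}$, an encoder mapping messages into $[-A,A]^n$, and a decoder mapping $\mathbb R^n$ to messages. A rate $R$ is achievable if there is a sequence of such codes ($n\to\infty$) whose probability of decoding error (for a uniformly distributed message) tends to $0$. The capacity $C$ is the supremum of achievable rates. *)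

(* Defs.v *)
From HB Require Import structures.
From mathcomp Require Import all_boot all_order all_algebra.
From mathcomp Require Import all_classical all_reals all_analysis.
Set Implicit Arguments.
Unset Strict Implicit.
Unset Printing Implicit Defensive.
Import Order.TTheory GRing.Theory Num.Theory.
Import numFieldNormedType.Exports.
Local Open Scope classical_set_scope.
Local Open Scope ring_scope.

(* The Landau notations need a canonical filter_on for their filter; the library
   declares none for at_right and pinfty_nbhs. *)
Canonical at_right_filter_on (R : realType) (x : R) :=
  FilterType x^'+ (at_right_proper_filter x).
Canonical pinfty_filter_on (R : realType) :=
  FilterType (pinfty_nbhs R) (@proper_pinfty_nbhs R).

Section iid.
Context d (T : measurableType d) (R : realType).

Definition tuple_cons n (zt : T * n.-tuple T) : n.+1.-tuple T :=
  [tuple of zt.1 :: zt.2].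

Lemma measurable_tuple_cons n : measurable_fun setT (@tuple_cons n).
Proof.
exact: (@measurable_cons _ _ _ _ fst n snd measurable_fst measurable_snd).
Qed.

HB.instance Definition _ n :=
  isMeasurableFun.Build _ _ _ _ (@tuple_cons n) (@measurable_tuple_cons n).

(* The n-fold product of P on n.-tuple T, i.e. the joint law of n independent
   random variables of law P; [iid_law_box] is its characteristic property. *)
Fixpoint iid_law (P : probability T R) n : probability (n.-tuple T) R :=
  if n is n'.+1 return probability (n.-tuple T) R
  then distribution (P \x iid_law P n')%E (@tuple_cons n')
  else \d_([tuple] : 0.-tuple T).

Lemma iid_law_box (P : probability T R) n (B : 'I_n -> set T) :
  (forall i, measurable (B i)) ->
  iid_law P n [set t | forall i, B i (tnth t i)] = (\prod_(i < n) P (B i))%E.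
Proof.
elim: n B => [|n IHn] B mB.
  rewrite big_ord0 /= diracE mem_set//= => -[].
  by case.
rewrite big_ord_recl -(IHn (fun i => B (lift ord0 i)))//.
rewrite /= /distribution /pushforward -product_measure1E//; last first.
  rewrite [X in measurable X](_ : _ =
    \bigcap_(i in [set: 'I_n]) ((@tnth _ T ^~ i) @^-1` B (lift ord0 i))).
    by apply: fin_bigcap_measurable => // i _; rewrite -[_ @^-1` _]setTI;
      exact: measurable_tnth.
  by apply/seteqP; split=> t /= h i => [_|]; exact: h.
congr (product_measure1 _ _ _); apply/seteqP; split=> -[z t] /=.
  move=> h; split; first exact: (h ord0).
  by move=> i; have := h (lift ord0 i); rewrite tnthS.
move=> [h0 h] i; have [j ->|->] := unliftP ord0 i; last exact: h0.
by rewrite tnthS.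
Qed.

End iid.

Section awgn.
Context {R : realType}.

(* n.-tuple R carries the same sigma-algebra up to conversion, but lebesgue_measure
   and normal_prob live on measurableTypeR R, whose display differs from R's. *)
Local Notation borelR := (measurableTypeR R).

(* The library's normal_prob takes the standard deviation, not the variance. *)
Definition awgn_noise (nu : R) n : probability (n.-tuple borelR) R :=
  iid_law (normal_prob 0 (Num.sqrt nu)) n.

Definition awgn_output n (x z : n.-tuple R) : n.-tuple borelR :=
  [tuple tnth x i + tnth z i | i < n].

Record code (A : R) (n M : nat) := Code {
  encode : 'I_M -> n.-tuple R;
  decode : n.-tuple borelR -> 'I_M;
  amplitude_encode : forall m i, `|tnth (encode m) i| <= A;
  measurable_decode : forall m, measurable (decode @^-1` [set m]) }.

(* Average over a uniformly distributed message, independent of the noise. *)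
Definition error_probability (nu A : R) n M (c : code A n M) : \bar R :=
  ((M%:R^-1 : R)%:E * \sum_(m < M) awgn_noise nu n
     [set z | decode c (awgn_output (encode c m) z) <> m])%E.

Definition message_count (r : R) (n : nat) : nat :=
  Num.truncn (expR (n%:R * r)).

(* No sign condition on r is needed: if r < 0, then message_count r n = 0 for
   n > 0, and [code A n 0] is empty because of its decoder. *)
Definition achievable (A nu r : R) : Prop :=
  exists c : forall n, code A n (message_count r n),
    error_probability nu (c n) @[n --> \oo] --> 0%E.

Definition capacity (A nu : R) : \bar R :=
  ereal_sup [set r%:E | r in achievable A nu].

End awgn.

(* Main.v *)
(* Write W(.|x) for the output law of input x and Q for a reference output law.
   If the information density i = log dW(.|x)/dQ has mean at most D for every admissible
   input x, no rate above D is achievable: a decoding region has W-mass at most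
   exp(n gam) times its Q-mass, up to the event {sum of the i's > n gam}, whose
   probability is exponentially small when D < gam (Chernoff).  Conversely, Feinstein's
   greedy codebook achieves every rate below D if i has mean at least D for all inputs in
   a set S carrying an input law whose output law is at most Q; each new codeword is found
   one coordinate at a time, so that no random codebook is needed.

   As nu -> 0, the converse takes Q uniform on [-A, A] with Gaussian tails of width
   nu^(1/3), and the direct part takes Q = Lebesgue / 2A with uniform inputs: in both cases
   i is bounded by a function of the noise alone.  As nu -> oo, Q is the output law of the
   input uniform on {-A, A}; then E i involves E log cosh(A Y / nu), and the alternating
   Taylor bounds of log c in c - 1 >= 0 at c = cosh u are combinations of cosh (j u), whose
   Gaussian means are explicit exponentials of A^2 / nu. *)
From HB Require Import structures.
Require Import Defs.
From mathcomp Require Import all_boot all_order all_algebra.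
From mathcomp Require Import all_classical all_reals all_analysis.
From mathcomp Require Import measurable_realfun ring lra.
Set Implicit Arguments.
Unset Strict Implicit.
Unset Printing Implicit Defensive.
Import Order.TTheory GRing.Theory Num.Theory.
Import numFieldNormedType.Exports.
Local Open Scope classical_set_scope.
Local Open Scope ring_scope.

Local Notation borelR R := (measurableTypeR R).

Import HBNNSimple.

(** * Densities and translations *)

(** Densities are taken relative to the noise law itself, so that every n-letter integral is over
    the single product [iid_law P n] and a shift of the noise is a reweighting of it. Both coding
    theorems ask only for a one-letter exponential moment bounded by some [rho < 1] uniformly over
    the inputs; independence turns it into [rho ^+ n] for every codeword, whatever its composition.
    No maximization over input laws occurs: any reference law gives an upper bound, any input law a
    lower one. In the direct part the reference only has to dominate an output law, so it may have
    infinite mass, as Lebesgue / 2A does.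

    For large noise, antipodal inputs suffice because, to the computed order, the mean information
    of an input in [-A, A] is largest at the two ends. The degrees of the Taylor bounds come from u
    = A Y / nu: cosh u - 1 is about u^2 / 2, and u^2 has mean of order s = A^2 / nu = alpha^2, so a
    term (cosh u - 1)^5 contributes O(alpha^10). Degrees 4 and 5, one on each side of log, therefore
    yield exactly the four displayed terms. *)

Lemma integral_density d (T : measurableType d) (R : realType)
    (mu nu : {measure set T -> \bar R}) (g : T -> R) :
  measurable_fun setT g -> (forall x, 0 <= g x) ->
  (forall A, measurable A -> nu A = \int[mu]_(x in A) (g x)%:E)%E ->
  forall f : T -> \bar R, measurable_fun setT f -> (forall x, 0 <= f x)%E ->
  (\int[nu]_x f x = \int[mu]_x (f x * (g x)%:E))%E.
Proof.
move=> mg g0 nug.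
have Hind (A : set T) : measurable A ->
    (\int[nu]_x (\1_A x)%:E = \int[mu]_x ((\1_A x)%:E * (g x)%:E))%E.
  move=> mA; rewrite integral_indic// setIT nug// integral_mkcond.
  apply: eq_integral => x _; rewrite patchE indicE.
  by case: ifPn => _; rewrite ?mul1e ?mul0e.
have Hsf (h : {nnsfun T >-> R}) :
    (\int[nu]_x (h x)%:E = \int[mu]_x ((h x)%:E * (g x)%:E))%E.
  under eq_integral do rewrite fimfunE -fsumEFin//.
  rewrite ge0_integral_fsum//; last 2 first.
  - by move=> r; exact/measurable_EFinP/measurableT_comp.
  - by move=> r x _; rewrite EFinM nnfun_muleindic_ge0.
  under [RHS]eq_integral.
    move=> x _; rewrite fimfunE -fsumEFin// muleC ge0_mule_fsumr; last first.
      by move=> r; rewrite EFinM nnfun_muleindic_ge0.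
    over.
  rewrite [RHS]ge0_integral_fsum//; last 2 first.
  - move=> r; apply: emeasurable_funM; first exact/measurable_EFinP.
    exact/measurable_EFinP/measurableT_comp.
  - by move=> r x _; apply: mule_ge0; [rewrite lee_fin|rewrite EFinM nnfun_muleindic_ge0].
  apply: eq_fsbigr => r /[!inE] -[x _ <-].
  rewrite (eq_integral (fun t => (h x)%:E * (\1_(h @^-1` [set h x]) t)%:E)%E)//.
  rewrite ge0_integralZl ?lee_fin//; last exact/measurable_EFinP.
  rewrite Hind// -ge0_integralZl ?lee_fin//.
  - by apply: eq_integral => t _; rewrite EFinM muleA [RHS]muleC.
  - apply: emeasurable_funM; last exact/measurable_EFinP.
    exact/measurable_EFinP/measurable_indic.
  - by move=> t _; rewrite mule_ge0 ?lee_fin.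
move=> f mf f0.
pose h := nnsfun_approx measurableT mf.
have fE x : f x = limn (EFin \o h ^~ x).
  by apply/esym/cvg_lim => //; exact: cvg_nnsfun_approx.
have fgE x : (f x * (g x)%:E)%E = limn (fun n => (h n x)%:E * (g x)%:E)%E.
  by apply/esym/cvg_lim => //; apply: cvgeZr => //; exact: cvg_nnsfun_approx.
transitivity (limn (fun n => \int[nu]_x (h n x)%:E))%E.
  rewrite -monotone_convergence//.
  - exact: eq_integral.
  - by move=> n; exact/measurable_EFinP.
  - by move=> n x _; rewrite lee_fin.
  - by move=> x _ a b ab; rewrite lee_fin; exact/lefP/nd_nnsfun_approx.
under eq_fun do rewrite Hsf.
rewrite -monotone_convergence//.
- by apply: eq_integral => x _; rewrite fgE.
- by move=> n; exact/measurable_EFinP/measurable_funM.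
- by move=> n x _; rewrite mule_ge0 ?lee_fin.
- move=> x _ a b ab; rewrite lee_pmul ?lee_fin//.
  by apply/lefP/nd_nnsfun_approx.
Qed.

Lemma integral_normal_prob (R : realType) (m s : R) (f : borelR R -> \bar R) :
  measurable_fun setT f -> (forall x, 0 <= f x)%E ->
  (\int[normal_prob m s]_x f x
   = \int[lebesgue_measure]_x (f x * (normal_pdf m s x)%:E))%E.
Proof.
apply: integral_density => //.
- exact: measurable_normal_pdf.
- exact: normal_pdf_ge0.
Qed.

Lemma ge0_integral_shift (R : realType) (c : R) (f : borelR R -> \bar R) :
  measurable_fun setT f -> (forall x, 0 <= f x)%E ->
  (\int[lebesgue_measure]_x f (c + x)%R = \int[lebesgue_measure]_x f x)%E.
Proof.
move=> mf f0.
have mc : measurable_fun setT ((fun x => c + x) : borelR R -> borelR R).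
  exact: measurable_funD.
pose phi_mixin := isMeasurableFun.Build _ _ _ _ _ mc.
pose phi : {mfun borelR R >-> borelR R} :=
  HB.pack ((fun x => c + x) : borelR R -> borelR R) phi_mixin.
transitivity (\int[pushforward lebesgue_measure phi]_x f x)%E.
  by rewrite ge0_integral_pushforward.
apply: eq_measure_integral => A mA _.
(* Uniqueness of Lebesgue measure reduces translation invariance to the lengths of half-open
   intervals. *)
apply/esym; apply: lebesgue_measure_unique => //= _ [[a b]] _ <-.
rewrite /pushforward [X in _ = lebesgue_measure X](_ : _ = `]a - c, b - c]%classic).
  rewrite !lebesgue_measure_itv/= !lte_fin ltrD2r.
  by case: ifP => // _; rewrite -!EFinD; congr EFin; ring.
by apply/seteqP; split=> x /=; rewrite !in_itv/= ltrBlDl lerBrDl.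
Qed.

(** * Independent noise *)

Lemma tnth_tuple_cons0 d (T : measurableType d) n (z : T) (t : n.-tuple T) :
  tnth (tuple_cons (z, t)) ord0 = z.
Proof. by []. Qed.

Lemma tnth_tuple_consS d (T : measurableType d) n (z : T) (t : n.-tuple T) i :
  tnth (tuple_cons (z, t)) (lift ord0 i) = tnth t i.
Proof. by rewrite /tuple_cons/= tnthS. Qed.

Lemma ge0_integral_iid_lawS d (T : measurableType d) (R : realType)
    (P : probability T R) n (f : n.+1.-tuple T -> \bar R) :
  measurable_fun setT f -> (forall t, 0 <= f t)%E ->
  (\int[iid_law P n.+1]_t f t
   = \int[P]_z \int[iid_law P n]_t f (tuple_cons (z, t)))%E.
Proof.
move=> mf f0.
rewrite [LHS](ge0_integral_pushforward (measurable_tuple_cons (n := n)))//.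
rewrite -(fubini_tonelli1 (f \o @tuple_cons _ _ _))//; first exact: measurableT_comp.
by move=> z; exact: f0.
Qed.

Lemma integral_iid_law0 d (T : measurableType d) (R : realType)
    (P : probability T R) (f : 0.-tuple T -> \bar R) :
  measurable_fun setT f -> (\int[iid_law P 0]_t f t = f [tuple])%E.
Proof. by move=> mf; rewrite integral_dirac// diracT mul1e. Qed.

Lemma measurable_prod_tnth d (T : measurableType d) (R : realType) n
    (f : 'I_n -> T -> R) : (forall i, measurable_fun setT (f i)) ->
  measurable_fun setT (fun t : n.-tuple T => \prod_i f i (tnth t i)).
Proof.
move=> mf; apply: measurable_prod => i _.
by apply: measurableT_comp => //; exact: measurable_tnth.
Qed.

Lemma measurable_sum_tnth d (T : measurableType d) (R : realType) n
    (f : 'I_n -> T -> R) : (forall i, measurable_fun setT (f i)) ->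
  measurable_fun setT (fun t : n.-tuple T => \sum_i f i (tnth t i)).
Proof.
move=> mf; apply: measurable_sum => i.
by apply: measurableT_comp => //; exact: measurable_tnth.
Qed.

Lemma integral_iid_law_prod d (T : measurableType d) (R : realType)
    (P : probability T R) n (f : 'I_n -> T -> R) :
  (forall i, measurable_fun setT (f i)) -> (forall i z, 0 <= f i z) ->
  (\int[iid_law P n]_t (\prod_i f i (tnth t i))%:E
   = \prod_i \int[P]_z (f i z)%:E)%E.
Proof.
elim: n f => [|n IHn] f mf f0.
  rewrite integral_iid_law0; last first.
    by apply/measurable_EFinP; exact: measurable_prod_tnth mf.
  by rewrite !big_ord0.
rewrite ge0_integral_iid_lawS; last 2 first.
- by apply/measurable_EFinP; exact: measurable_prod_tnth mf.
- by move=> t; rewrite lee_fin prodr_ge0.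
have E (z : T) : (\int[iid_law P n]_t (\prod_i f i (tnth (tuple_cons (z, t)) i))%:E
    = (f ord0 z)%:E * \prod_(i < n) \int[P]_y (f (lift ord0 i) y)%:E)%E.
  rewrite -(IHn (fun i => f (lift ord0 i)))// -ge0_integralZl ?lee_fin//.
  - apply: eq_integral => t _; rewrite big_ord_recl tnth_tuple_cons0 EFinM.
    by congr (_ * (_)%:E)%E; apply: eq_bigr => i _; rewrite tnth_tuple_consS.
  - apply/measurable_EFinP.
    exact: (@measurable_prod_tnth _ T _ _ (fun i => f (lift ord0 i))).
  - by move=> t _; rewrite lee_fin prodr_ge0.
under eq_integral do rewrite E.
rewrite big_ord_recl ge0_integralZr//.
- exact/measurable_EFinP.
- by move=> z _; rewrite lee_fin.
- by rewrite prode_ge0// => i _; apply: integral_ge0 => z _; rewrite lee_fin.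
Qed.

Lemma measurable_awgn_output (R : realType) n (x : n.-tuple R) :
  measurable_fun setT (awgn_output x).
Proof.
apply/measurable_fun_tnthP => i.
rewrite (_ : _ \o _ = fun z : n.-tuple (borelR R) => tnth x i + tnth z i).
  apply: measurable_funD => //; exact: measurable_tnth.
by apply/funext => z /=; rewrite tnth_mktuple.
Qed.

Lemma awgn_output_cons (R : realType) n (x : n.+1.-tuple R) (z : borelR R)
    (t : n.-tuple (borelR R)) :
  awgn_output x (tuple_cons (z, t)) =
  tuple_cons ((tnth x ord0 + z : borelR R), awgn_output [tuple of behead x] t).
Proof.
apply: eq_from_tnth => i; rewrite tnth_mktuple.
have [j ->|->] := unliftP ord0 i; last by rewrite !tnth_tuple_cons0.
by rewrite !tnth_tuple_consS tnth_mktuple tnth_behead; congr (tnth x _ + _);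
  apply/val_inj; rewrite /= inordK// ltnS.
Qed.

Lemma measurable_tuple_cons_pair d (T : measurableType d) n d' (U : measurableType d')
    (f : n.+1.-tuple T -> U) :
  measurable_fun setT f ->
  measurable_fun setT (fun zt : T * n.-tuple T => f (tuple_cons zt)).
Proof. by move=> mf; apply: measurableT_comp => //; exact: measurable_tuple_cons. Qed.

Lemma tnth_behead_lift (T : Type) n (t : n.+1.-tuple T) i :
  tnth [tuple of behead t] i = tnth t (lift ord0 i).
Proof. by rewrite tnth_behead; congr (tnth t _); apply/val_inj; rewrite /= inordK// ltnS. Qed.

(** Densities tensorize. The one-letter formula is applied to the first coordinate after the others
    have been integrated out, which is why its hypothesis ranges over all nonnegative measurable
    [F], infinite values included. *)
Lemma integral_iid_law_shift (R : realType) (P : probability (borelR R) R)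
    (w : R -> borelR R -> R) :
  (forall x, measurable_fun setT (w x)) -> (forall x y, 0 <= w x y) ->
  (forall x (F : borelR R -> \bar R), measurable_fun setT F ->
     (forall y, 0 <= F y)%E ->
     (\int[P]_z F (x + z)%R = \int[P]_y (F y * (w x y)%:E))%E) ->
  forall n (x : n.-tuple R) (f : n.-tuple (borelR R) -> \bar R),
    measurable_fun setT f -> (forall t, 0 <= f t)%E ->
  (\int[iid_law P n]_z f (awgn_output x z)
   = \int[iid_law P n]_y (f y * (\prod_i w (tnth x i) (tnth y i))%:E))%E.
Proof.
move=> mw w0 H; elim=> [|n IHn] x f mf f0.
  rewrite !integral_iid_law0.
  - by rewrite big_ord0 mule1; congr f; apply: eq_from_tnth => -[].
  - apply: emeasurable_funM => //; apply/measurable_EFinP.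
    exact: (@measurable_prod_tnth _ _ _ _ (fun i => w (tnth x i))).
  - by apply: measurableT_comp => //; exact: measurable_awgn_output.
set x' : n.-tuple R := [tuple of behead x].
pose W (y : n.-tuple (borelR R)) := \prod_i w (tnth x' i) (tnth y i).
have mW : measurable_fun setT W.
  exact: (@measurable_prod_tnth _ _ _ _ (fun i => w (tnth x' i))).
have W0 y : 0 <= W y by rewrite prodr_ge0.
have mfc := measurable_tuple_cons_pair mf.
have mfW : measurable_fun setT
    (fun zt : borelR R * n.-tuple (borelR R) => f (tuple_cons zt) * (W zt.2)%:E)%E.
  apply: emeasurable_funM => //; apply/measurable_EFinP.
  exact: measurableT_comp.
rewrite [LHS]ge0_integral_iid_lawS//; last first.
  by apply: measurableT_comp => //; exact: measurable_awgn_output.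
rewrite [RHS]ge0_integral_iid_lawS//; first last.
- by move=> t; rewrite mule_ge0// lee_fin prodr_ge0.
- apply: emeasurable_funM => //; apply/measurable_EFinP.
  exact: (@measurable_prod_tnth _ _ _ _ (fun i => w (tnth x i))).
pose F (y0 : borelR R) := (\int[iid_law P n]_t (f (tuple_cons (y0, t)) * (W t)%:E))%E.
transitivity (\int[P]_z F (tnth x ord0 + z)%R)%E.
  apply: eq_integral => z _; rewrite /F.
  under eq_integral do rewrite awgn_output_cons.
  rewrite (IHn x' (fun t => f (tuple_cons (tnth x ord0 + z : borelR R, t))))//.
  exact: measurableT_comp mfc _.
rewrite H//; first last.
- by move=> y; apply: integral_ge0 => t _; rewrite mule_ge0 ?lee_fin.
- apply: (measurable_fun_fubini_tonelli_F (m2 := iid_law P n) _ mfW) => zt.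
  by rewrite mule_ge0 ?lee_fin.
apply: eq_integral => y _; rewrite /F -ge0_integralZr ?lee_fin//.
- apply: eq_integral => t _; rewrite big_ord_recl EFinM -muleA.
  congr (_ * _)%E; rewrite muleC; congr ((_)%:E * (_)%:E)%E.
  by apply: eq_bigr => i _; rewrite tnth_tuple_consS tnth_behead_lift.
- exact: measurableT_comp mfW _.
- by move=> t _; rewrite mule_ge0 ?lee_fin.
Qed.

(* A codeword whose conditional output law does not exceed the averaged law on a
   given function is found one coordinate at a time. *)
Lemma iid_law_exists_input (R : realType) (P : probability (borelR R) R)
    (S : set R) (q : borelR R -> R) :
  measurable_fun setT q -> (forall y, 0 <= q y) ->
  (forall F : borelR R -> \bar R, measurable_fun setT F ->
     (forall y, 0 <= F y)%E ->
     exists2 x, S x & (\int[P]_z F (x + z)%R <= \int[P]_y (F y * (q y)%:E))%E) ->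
  forall n (f : n.-tuple (borelR R) -> \bar R),
    measurable_fun setT f -> (forall t, 0 <= f t)%E ->
  exists2 x : n.-tuple R, (forall i, S (tnth x i)) &
  (\int[iid_law P n]_z f (awgn_output x z)
   <= \int[iid_law P n]_y (f y * (\prod_i q (tnth y i))%:E))%E.
Proof.
move=> mq q0 H; elim=> [|n IHn] f mf f0.
  exists [tuple]; first by case.
  rewrite !integral_iid_law0.
  - rewrite big_ord0 mule1 (_ : awgn_output _ _ = [tuple])//.
    by apply: eq_from_tnth => -[].
  - apply: emeasurable_funM => //; apply/measurable_EFinP.
    exact: (@measurable_prod_tnth _ _ _ _ (fun=> q)).
  - by apply: measurableT_comp => //; exact: measurable_awgn_output.
pose Q (y : n.-tuple (borelR R)) := \prod_i q (tnth y i).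
have mQ : measurable_fun setT Q by exact: (@measurable_prod_tnth _ _ _ _ (fun=> q)).
have Q0 y : 0 <= Q y by rewrite prodr_ge0.
have mfc := measurable_tuple_cons_pair mf.
have mfQ : measurable_fun setT
    (fun zt : borelR R * n.-tuple (borelR R) => f (tuple_cons zt) * (Q zt.2)%:E)%E.
  apply: emeasurable_funM => //; apply/measurable_EFinP.
  exact: measurableT_comp.
(* The first input [x0] is chosen while the other coordinates still carry the averaged law. The
   induction then runs on [f'], where the first coordinate has been integrated out under the choice
   [x0]; Tonelli relates the two orders of integration. *)
pose F (y0 : borelR R) := (\int[iid_law P n]_t (f (tuple_cons (y0, t)) * (Q t)%:E))%E.
have mF : measurable_fun setT F.
  apply: (measurable_fun_fubini_tonelli_F (m2 := iid_law P n) _ mfQ) => zt.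
  by rewrite mule_ge0 ?lee_fin.
have F0 y : (0 <= F y)%E.
  by apply: integral_ge0 => t _; rewrite mule_ge0 ?lee_fin.
have [x0 Sx0 x0F] := H F mF F0.
have mshift : measurable_fun setT
    (fun zt : borelR R * n.-tuple (borelR R) => f (tuple_cons ((x0 + zt.1)%R : borelR R, zt.2))).
  apply: (measurableT_comp (f := fun zt => f (tuple_cons zt))) => //.
  by apply: measurable_fun_pair => //; exact: measurable_funD.
pose f' (t : n.-tuple (borelR R)) :=
  (\int[P]_z f (tuple_cons ((x0 + z)%R : borelR R, t)))%E.
have mf' : measurable_fun setT f'.
  exact: (measurable_fun_fubini_tonelli_G (m1 := P) _ mshift).
have f'0 t : (0 <= f' t)%E by exact: integral_ge0.
have [x' Sx' x'f'] := IHn f' mf' f'0.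
exists [tuple of x0 :: x'].
  by move=> i; have [j ->|->] := unliftP ord0 i; rewrite ?tnthS.
rewrite ge0_integral_iid_lawS//; last first.
  by apply: measurableT_comp => //; exact: measurable_awgn_output.
rewrite [leRHS]ge0_integral_iid_lawS//; first last.
- by move=> t; rewrite mule_ge0// lee_fin prodr_ge0.
- apply: emeasurable_funM => //; apply/measurable_EFinP.
  exact: (@measurable_prod_tnth _ _ _ _ (fun=> q)).
have -> : (\int[P]_z \int[iid_law P n]_t
    (f (tuple_cons (z, t)) * (\prod_i q (tnth (tuple_cons (z, t)) i))%:E)
  = \int[P]_y (F y * (q y)%:E))%E.
  apply: eq_integral => y _; rewrite /F -ge0_integralZr ?lee_fin//.
  - apply: eq_integral => t _; rewrite big_ord_recl EFinM -muleA.
    congr (_ * _)%E; rewrite muleC; congr ((_)%:E * (_)%:E)%E.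
    by apply: eq_bigr => i _; rewrite tnth_tuple_consS.
  - exact: measurableT_comp mfQ _.
  - by move=> t _; rewrite mule_ge0 ?lee_fin.
apply: le_trans x0F.
pose g (zt : borelR R * n.-tuple (borelR R)) :=
  f (tuple_cons ((x0 + zt.1)%R : borelR R, awgn_output x' zt.2)).
have mg : measurable_fun setT g.
  apply: (measurableT_comp (f := fun zt => f (tuple_cons zt))) => //.
  apply: measurable_fun_pair; first exact: measurable_funD.
  by apply: measurableT_comp => //; exact: measurable_awgn_output.
have g0 zt : (0 <= g zt)%E by exact: f0.
have swapg := fubini_tonelli (m1 := P) (m2 := iid_law P n) g mg g0.
pose h (zt : borelR R * n.-tuple (borelR R)) :=
  (f (tuple_cons ((x0 + zt.1)%R : borelR R, zt.2)) * (Q zt.2)%:E)%E.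
have mh : measurable_fun setT h.
  apply: emeasurable_funM; first exact: mshift.
  apply/measurable_EFinP.
  exact: measurableT_comp.
have h0 zt : (0 <= h zt)%E by rewrite mule_ge0 ?lee_fin.
have swaph := fubini_tonelli (m1 := P) (m2 := iid_law P n) h mh h0.
have -> : (\int[P]_z \int[iid_law P n]_t
    f (awgn_output [tuple of x0 :: x'] (tuple_cons (z, t)))
  = \int[iid_law P n]_t f' (awgn_output x' t))%E.
  rewrite -[RHS]swapg; apply: eq_integral => z _; apply: eq_integral => t _.
  rewrite awgn_output_cons /g /=; congr (f (tuple_cons (_, awgn_output _ _))).
  exact/val_inj.
have -> : (\int[P]_z F (x0 + z)%R = \int[iid_law P n]_t (f' t * (Q t)%:E))%E.
  rewrite -[LHS]/(\int[P]_z \int[iid_law P n]_t h (z, t))%E.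
  rewrite [LHS]swaph; apply: eq_integral => t _.
  rewrite /fubini_G /h /f' /= ge0_integralZr ?lee_fin//.
  exact: (measurableT_comp mshift (measurable_pair2 t)).
exact: x'f'.
Qed.

(** * Information densities of product laws *)

Lemma measurable_ltr_set d (T : measurableType d) (R : realType) (f g : T -> R) :
  measurable_fun setT f -> measurable_fun setT g ->
  measurable [set t | f t < g t].
Proof.
move=> mf mg; rewrite -[X in measurable X]setTI.
exact: (measurable_fun_ltr mf mg measurableT (Y := [set true])).
Qed.

Lemma measure_preimage_integral d d' (T : measurableType d) (U : measurableType d')
    (R : realType) (mu : {measure set T -> \bar R}) (phi : T -> U) (B : set U) :
  measurable_fun setT phi -> measurable B ->
  mu (phi @^-1` B) = (\int[mu]_x (\1_B (phi x))%:E)%E.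
Proof.
move=> mphi mB.
have mpre : measurable (phi @^-1` B) by rewrite -[_ @^-1` _]setTI; exact: mphi.
by have := integral_indic mu measurableT mpre; rewrite setIT => <-.
Qed.

Lemma prode_le (R : realType) n (F : 'I_n -> \bar R) (r : R) :
  (forall i, (0 <= F i <= r%:E)%E) -> (\prod_i F i <= (r ^+ n)%:E)%E.
Proof.
elim: n F => [|n IHn] F F0; first by rewrite big_ord0 expr0.
rewrite big_ord_recl exprS EFinM; have /andP[F00 F0r] := F0 ord0.
apply: lee_pmul => //; first by apply: prode_ge0 => i _; case/andP: (F0 (lift ord0 i)).
exact: IHn.
Qed.

Lemma integral_iid_law_expR_le (R : realType) d (T : measurableType d)
    (P : probability T R) n (g : 'I_n -> T -> R) (rho : R) :
  (forall k, measurable_fun setT (g k)) ->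
  (forall k, \int[P]_z (expR (g k z))%:E <= rho%:E)%E ->
  (\int[iid_law P n]_t (expR (\sum_k g k (tnth t k)))%:E <= (rho ^+ n)%:E)%E.
Proof.
move=> mg grho.
under eq_integral do rewrite expR_sum.
rewrite (@integral_iid_law_prod _ _ _ P n (fun k z => expR (g k z))).
- apply: prode_le => k; rewrite grho andbT.
  by apply: integral_ge0 => z _; rewrite lee_fin expR_ge0.
- by move=> k; apply: measurableT_comp => //; exact: measurable_expR.
- by move=> k z; exact: expR_ge0.
Qed.

(* [q] is a reference output density and [x + z] has density [q * expR (i x)]:
   [i] is the information density of the output given the input [x]. *)
Definition has_information_density {R : realType} (P : probability (borelR R) R)
    (q : borelR R -> R) (i : R -> borelR R -> R) : Prop :=
  [/\ measurable_fun setT q, forall y, 0 <= q y, forall x, measurable_fun setT (i x) &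
   forall x (F : borelR R -> \bar R), measurable_fun setT F ->
     (forall y, 0 <= F y)%E ->
     (\int[P]_z F (x + z)%R = \int[P]_y (F y * (q y * expR (i x y))%:E))%E].

Lemma integral_iid_law_density (R : realType) (P : probability (borelR R) R)
    (q : borelR R -> R) (i : R -> borelR R -> R) :
  has_information_density P q i ->
  forall n (x : n.-tuple R) (f : n.-tuple (borelR R) -> \bar R),
    measurable_fun setT f -> (forall t, 0 <= f t)%E ->
  (\int[iid_law P n]_z f (awgn_output x z)
   = \int[iid_law P n]_y (f y * ((\prod_k q (tnth y k)) *
       expR (\sum_k i (tnth x k) (tnth y k)))%:E))%E.
Proof.
move=> [mq q0 mi H] n x f mf f0.
rewrite (integral_iid_law_shift (w := fun x y => q y * expR (i x y)))//.
- by apply: eq_integral => y _; rewrite expR_sum -big_split.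
- by move=> x'; apply: measurable_funM => //; apply: measurableT_comp => //;
    exact: measurable_expR.
- by move=> *; rewrite mulr_ge0 ?expR_ge0.
Qed.

Lemma correct_probability_le (R : realType) (P : probability (borelR R) R)
    (q : borelR R -> R) (i : R -> borelR R -> R) (lam gam rho : R) n
    (x : n.-tuple R) (B : set (n.-tuple (borelR R))) :
  has_information_density P q i -> 0 < lam -> measurable B ->
  (forall k, \int[P]_z (expR (lam * (i (tnth x k) (tnth x k + z)%R - gam)))%:E
     <= rho%:E)%E ->
  (iid_law P n (awgn_output x @^-1` B) <=
   (expR (n%:R * gam))%:E *
     \int[iid_law P n]_y (\1_B y * \prod_k q (tnth y k))%:E
   + (rho ^+ n)%:E)%E.
Proof.
move=> H lam0 mB Hrho; have [mq q0 mi _] := H.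
pose Q (y : n.-tuple (borelR R)) := \prod_k q (tnth y k).
pose I (y : n.-tuple (borelR R)) := \sum_k i (tnth x k) (tnth y k).
have mQ : measurable_fun setT Q by exact: (@measurable_prod_tnth _ _ _ _ (fun=> q)).
have mI : measurable_fun setT I.
  exact: (@measurable_sum_tnth _ _ _ _ (fun k => i (tnth x k))).
have Q0 y : 0 <= Q y by rewrite prodr_ge0.
have mexp (f : n.-tuple (borelR R) -> R) : measurable_fun setT f ->
    measurable_fun setT (fun y => expR (f y)).
  by move=> mf; apply: measurableT_comp => //; exact: measurable_expR.
pose V y := lam * (I y - n%:R * gam).
have mV : measurable_fun setT V.
  by apply: measurable_funM => //; exact: measurable_funB.
rewrite measure_preimage_integral//; last exact: measurable_awgn_output.
have mB1 : measurable_fun setT (fun y => (\1_B y : R)%:E).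
  exact/measurable_EFinP/measurable_indic.
have B10 t : (0 <= (\1_B t : R)%:E)%E by rewrite lee_fin.
rewrite (@integral_iid_law_density _ _ _ _ H n x (fun y => (\1_B y)%:E))//.
have -> : ((expR (n%:R * gam))%:E * \int[iid_law P n]_y (\1_B y * Q y)%:E =
    \int[iid_law P n]_y (expR (n%:R * gam) * (\1_B y * Q y))%:E)%E.
  rewrite -ge0_integralZl ?lee_fin ?expR_ge0//.
  - exact/measurable_EFinP/measurable_funM.
  - by move=> y _; rewrite lee_fin mulr_ge0.
(* [f1] dominates the integrand where [I y <= n * gam], and [f2] where [n * gam < I y], since there
   [1 <= expR (V y)]. Hence [f1 + f2] dominates it everywhere. *)
pose f1 (y : n.-tuple (borelR R)) := (expR (n%:R * gam) * (\1_B y * Q y))%:E.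
pose f2 (y : n.-tuple (borelR R)) := ((expR (V y))%:E * (Q y * expR (I y))%:E)%E.
have mf1 : measurable_fun setT f1.
  by apply/measurable_EFinP; do 2 apply: measurable_funM => //.
have mf2 : measurable_fun setT f2.
  apply/measurable_EFinP; apply: measurable_funM; first exact: mexp mV.
  by apply: measurable_funM => //; exact: mexp mI.
have f10 y : (0 <= f1 y)%E by rewrite lee_fin !mulr_ge0 ?expR_ge0.
have f20 y : (0 <= f2 y)%E by rewrite lee_fin !mulr_ge0 ?expR_ge0.
apply: (@le_trans _ _ (\int[iid_law P n]_y f1 y + \int[iid_law P n]_y f2 y))%E; last first.
  apply: leeD => //.
  have V0 t : (0 <= (expR (V t))%:E)%E by rewrite lee_fin expR_ge0.
  have mexpV : measurable_fun setT (fun y => (expR (V y))%:E).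
    by apply/measurable_EFinP; exact: mexp mV.
  rewrite -(@integral_iid_law_density _ _ _ _ H n x (fun y => (expR (V y))%:E))//.
  pose g (k : 'I_n) (z : borelR R) := lam * (i (tnth x k) (tnth x k + z) - gam).
  rewrite (eq_integral (fun z => (expR (\sum_k g k (tnth z k)))%:E)).
    apply: integral_iid_law_expR_le => // k.
    apply: measurable_funM => //; apply: measurable_funB => //.
    have madd : measurable_fun setT
      ((fun z => tnth x k + z) : borelR R -> borelR R) by exact: measurable_funD.
    exact: measurableT_comp (mi (tnth x k)) madd.
  move=> z _; congr (expR _)%:E.
  rewrite /V /g -mulr_sumr sumrB sumr_const card_ord -[gam *+ n]mulr_natl; congr (_ * (_ - _)).
  by apply: eq_bigr => k _; rewrite tnth_mktuple.
rewrite -(@ge0_integralD _ _ _ (iid_law P n) setT measurableT f1 f2)//.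
have mQI : measurable_fun setT (fun y => (Q y * expR (I y))%:E).
  by apply/measurable_EFinP; apply: measurable_funM => //; exact: mexp mI.
have QI0 y : (0 <= (Q y * expR (I y))%:E)%E by rewrite lee_fin mulr_ge0 ?expR_ge0.
apply: ge0_le_integral => //.
- by move=> y _; apply: mule_ge0; [exact: B10|exact: QI0].
- exact: emeasurable_funM.
- exact: emeasurable_funD.
move=> y _; rewrite /f1 /f2 -!EFinM -EFinD lee_fin -/(I y) -/(Q y).
have [Igt|Ile] := ltP (n%:R * gam) (I y); last first.
  rewrite ler_wpDr ?mulr_ge0 ?expR_ge0// mulrA [leLHS]mulrC.
  by rewrite ler_wpM2r ?mulr_ge0// ler_expR.
rewrite ler_wpDl ?mulr_ge0 ?expR_ge0// ler_wpM2r ?mulr_ge0 ?expR_ge0//.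
apply: (@le_trans _ _ 1); first by rewrite indicE; case: (_ \in _).
by rewrite -expR0 ler_expR /V mulr_ge0 ?subr_ge0 ?ltW.
Qed.

(** * Coding theorems *)

Lemma code_size_gt0 (R : realType) (A : R) n M : Defs.code A n M -> (0 < M)%N.
Proof. by case=> _ dec _ _; case: (dec [tuple of nseq n (0 : borelR R)]) => m; case: M dec. Qed.

(** The decoding regions partition the output space, so their reference masses add up to at most 1:
    averaging [correct_probability_le] over the messages shares one factor [expR (n * gam)] among
    all [M] of them. *)
Lemma error_probability_ge (R : realType) (nu A : R)
    (q : borelR R -> R) (i : R -> borelR R -> R) (lam gam rho : R) n M
    (c : Defs.code A n M) :
  let P := normal_prob 0 (Num.sqrt nu) in
  has_information_density P q i -> (\int[P]_y (q y)%:E <= 1)%E -> 0 < lam ->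
  (forall x, `|x| <= A ->
     (\int[P]_z (expR (lam * (i x (x + z)%R - gam)))%:E <= rho%:E)%E) ->
  (1 <= error_probability nu c
        + (expR (n%:R * gam) / M%:R + rho ^+ n)%:E)%E.
Proof.
move=> P H q1 lam0 Hrho; have [mq q0 _ _] := H.
have M0 := code_size_gt0 c.
pose N : probability (n.-tuple (borelR R)) R := iid_law P n.
pose B m := Defs.decode c @^-1` [set m].
have mB m : measurable (B m) by exact: measurable_decode.
pose Q (y : n.-tuple (borelR R)) := \prod_k q (tnth y k).
have mQ : measurable_fun setT Q by exact: (@measurable_prod_tnth _ _ _ _ (fun=> q)).
have Q0 y : 0 <= Q y by rewrite prodr_ge0.
have mout m : measurable (awgn_output (Defs.encode c m) @^-1` B m).
  by rewrite -[_ @^-1` _]setTI; exact: measurable_awgn_output.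
pose J m := (\int[N]_y (\1_(B m) y * Q y)%:E)%E.
have J0 m : (0 <= J m)%E.
  by apply: integral_ge0 => y _; rewrite lee_fin mulr_ge0.
have sumJ : (\sum_m J m <= 1)%E.
  rewrite -ge0_integral_sum//; first last.
  - by move=> m y _; rewrite lee_fin mulr_ge0.
  - by move=> m; exact/measurable_EFinP/measurable_funM.
  rewrite (eq_integral (fun y => (Q y)%:E)).
    rewrite /Q (integral_iid_law_prod P (fun=> mq))//.
    apply: (@le_trans _ _ ((1 : R) ^+ n)%:E); last by rewrite expr1n.
    apply: prode_le => k.
    by rewrite q1 andbT; apply: integral_ge0 => z _; rewrite lee_fin.
  move=> y _; rewrite sumEFin -mulr_suml (bigD1 (Defs.decode c y))//= big1.
    by rewrite addr0 indicE mem_set// mul1r.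
  move=> m mE; rewrite indicE memNset// => /esym mE'.
  by rewrite mE' eqxx in mE.
pose e m := fine (N [set z | Defs.decode c (awgn_output (Defs.encode c m) z) <> m]).
have eE m : N [set z | Defs.decode c (awgn_output (Defs.encode c m) z) <> m] = (e m)%:E.
  rewrite fineK// fin_num_measure//.
  by rewrite -[X in measurable X]/(~` (awgn_output (Defs.encode c m) @^-1` B m));
    exact: measurableC (mout m).
have JE m : J m = (fine (J m))%:E.
  rewrite fineK// ge0_fin_numE// (@le_lt_trans _ _ 1%E) ?ltry//.
  apply: le_trans sumJ; rewrite (bigD1 m)//= leeDl//.
  by apply: sume_ge0 => *; exact: J0.
have key m : 1 <= e m + (expR (n%:R * gam) * fine (J m) + rho ^+ n).
  have Hc := @correct_probability_le _ P q i lam gam rho n (Defs.encode c m) (B m)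
    H lam0 (mB m) (fun k => Hrho _ (amplitude_encode c m k)).
  rewrite -lee_fin EFinD -eE -[X in N X]/(~` (awgn_output (Defs.encode c m) @^-1` B m)).
  rewrite probability_setC//; last exact: mout.
  move: Hc; rewrite -/N -/(J m) JE.
  rewrite -[N _]fineK ?fin_num_measure//; last exact: mout.
  rewrite -EFinM -!EFinD !lee_fin => Hc; lra.
have sumj : \sum_m fine (J m) <= 1.
  by rewrite -lee_fin -sumEFin; under eq_bigr do rewrite -JE.
rewrite /error_probability.
rewrite (eq_bigr (fun m => (e m)%:E)); last by move=> m _; rewrite -eE.
rewrite sumEFin -EFinM -EFinD lee_fin.
have Mgt0 : 0 < M%:R :> R by rewrite ltr0n.
have : \sum_(m < M) (1 : R) <=
    \sum_(m < M) (e m + (expR (n%:R * gam) * fine (J m) + rho ^+ n)).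
  by apply: ler_sum => m _; exact: key.
rewrite !big_split/= !sumr_const card_ord -mulr_sumr -[rho ^+ n *+ M]mulr_natl => Hs.
rewrite -(ler_pM2l Mgt0) mulr1 !mulrDr mulrA mulfV ?gt_eqF// mul1r.
rewrite mulrCA mulfV ?gt_eqF// mulr1.
apply: (le_trans Hs); rewrite lerD2l lerD2r.
by rewrite -[leRHS]mulr1 ler_wpM2l ?expR_ge0.
Qed.

(** A positive integer part loses at most a factor 2, which the exponential decay in [achievable_le]
    absorbs. *)
Lemma message_count_ge (R : realType) (r : R) n : (0 < message_count r n)%N ->
  expR (n%:R * r) <= 2 * (message_count r n)%:R.
Proof.
move=> M0.
have : expR (n%:R * r) < (message_count r n).+1%:R.
  by rewrite -Num.Theory.truncn_lt_nat// expR_ge0.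
move=> /ltW /le_trans; apply; rewrite -natrM ler_nat.
by rewrite mul2n -addnn -addn1 leq_add2l.
Qed.

Lemma achievable_le (R : realType) (nu A r : R)
    (q : borelR R -> R) (i : R -> borelR R -> R) (lam gam rho : R) :
  let P := normal_prob 0 (Num.sqrt nu) in
  has_information_density P q i -> (\int[P]_y (q y)%:E <= 1)%E -> 0 < lam ->
  0 <= rho < 1 ->
  (forall x, `|x| <= A ->
     (\int[P]_z (expR (lam * (i x (x + z)%R - gam)))%:E <= rho%:E)%E) ->
  achievable A nu r -> r <= gam.
Proof.
move=> P H q1 lam0 /andP[rho0 rho1] Hrho [c cvgc].
rewrite leNgt; apply/negP => gamr.
(* The first term bounds [expR (n * gam) / M]. If [gam < r], then [s] tends to 0 like the error
   probability, while their sum stays at least 1. *)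
pose s n := 2 * expR (- (r - gam)) ^+ n + rho ^+ n.
have cvgs : s @ \oo --> (0 : R).
  rewrite -[X in _ --> X](_ : 2 * 0 + 0 = 0); last by rewrite mulr0 addr0.
  apply: cvgD; last by apply: cvg_expr; rewrite ger0_norm.
  apply: cvgM; [exact: cvg_cst|apply: cvg_expr]; rewrite ger0_norm ?expR_ge0//.
  by rewrite -expR0 ltr_expR oppr_lt0 subr_gt0.
have cvgs' : (s n)%:E @[n --> \oo] --> 0%E.
  by apply: cvg_EFin; [exact: nearW|exact: cvgs].
have cvgcs : (error_probability nu (c n) + (s n)%:E)%E @[n --> \oo] --> 0%E.
  by rewrite -[X in _ --> X](adde0 0%E); apply: cvgeD.
suff : (1 <= 0 :> \bar R)%E by rewrite lee_fin ler10.
apply: (cvge_ge _ cvgcs); apply: nearW => n.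
apply: le_trans (error_probability_ge (c n) H q1 lam0 Hrho) _.
rewrite leeD2l// lee_fin lerD2r.
have M0 := code_size_gt0 (c n).
have Mgt0 : 0 < (message_count r n)%:R :> R by rewrite ltr0n.
rewrite ler_pdivrMr// -expRM_natl mulrN mulrBr opprB expRD.
apply: (@le_trans _ _ (expR (n%:R * gam) * expR (- (n%:R * r)) * expR (n%:R * r))).
  by rewrite -mulrA -expRD addNr expR0 mulr1.
set a := expR _ * _.
rewrite (_ : 2 * a * _ = a * (2 * (message_count r n)%:R)); last by ring.
rewrite ler_wpM2l ?mulr_ge0 ?expR_ge0//.
exact: message_count_ge.
Qed.

(* Feinstein's greedy construction: the decoder outputs the first message whose
   information density with the output exceeds the threshold [n * gam], and each new
   codeword is chosen to make the regions of the previous ones unlikely. *)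
Lemma exists_code (R : realType) (nu A : R) (S : set R)
    (q : borelR R -> R) (i : R -> borelR R -> R) (lam gam rho : R) n M :
  let P := normal_prob 0 (Num.sqrt nu) in
  has_information_density P q i -> (forall x, S x -> `|x| <= A) ->
  (forall F : borelR R -> \bar R, measurable_fun setT F ->
     (forall y, 0 <= F y)%E ->
     exists2 x, S x & (\int[P]_z F (x + z)%R <= \int[P]_y (F y * (q y)%:E))%E) ->
  0 < lam ->
  (forall x, S x ->
     (\int[P]_z (expR (lam * (gam - i x (x + z)%R)))%:E <= rho%:E)%E) ->
  (0 < M)%N ->
  exists c : Defs.code A n M,
    (error_probability nu c <= (rho ^+ n + M%:R * expR (- (n%:R * gam)))%:E)%E.
Proof.
move=> P H SA avg lam0 Hrho M0; have [mq q0 mi _] := H.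
pose N : probability (n.-tuple (borelR R)) R := iid_law P n.
pose Q (y : n.-tuple (borelR R)) := \prod_k q (tnth y k).
have mQ : measurable_fun setT Q by exact: (@measurable_prod_tnth _ _ _ _ (fun=> q)).
have Q0 y : 0 <= Q y by rewrite prodr_ge0.
pose I (x : n.-tuple R) (y : n.-tuple (borelR R)) := \sum_k i (tnth x k) (tnth y k).
have mI x : measurable_fun setT (I x).
  exact: (@measurable_sum_tnth _ _ _ _ (fun k => i (tnth x k))).
pose G x := [set y | n%:R * gam < I x y].
have mG x : measurable (G x) by exact: measurable_ltr_set (mI x).
pose del := expR (- (n%:R * gam)).
have mout x (B : set (n.-tuple (borelR R))) : measurable B ->
    measurable (awgn_output x @^-1` B).
  by move=> mB; rewrite -[_ @^-1` _]setTI; exact: measurable_awgn_output.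
have mindQ (B : set (n.-tuple (borelR R))) : measurable B ->
    measurable_fun setT (fun y => (\1_B y * Q y)%:E).
  by move=> mB; exact/measurable_EFinP/measurable_funM.
have indQ0 (B : set (n.-tuple (borelR R))) y : (0 <= (\1_B y * Q y)%:E)%E.
  by rewrite lee_fin mulr_ge0.
(* On [G x] the reference density is at most [del] times the output density of [x], and the latter
   has mass at most 1. *)
have QG x : (\int[N]_y (\1_(G x) y * Q y)%:E <= del%:E)%E.
  pose h y := ((\1_(G x) y)%:E * (Q y * expR (I x y))%:E)%E.
  have mh : measurable_fun setT h.
    apply/measurable_EFinP; apply: measurable_funM => //.
    apply: measurable_funM => //.
    by apply: measurableT_comp => //; exact: measurable_expR.
  have h0 y : (0 <= h y)%E by rewrite lee_fin !mulr_ge0 ?expR_ge0.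
  have hE : (\int[N]_y h y <= 1)%E.
    have mind : measurable_fun setT (fun y => (\1_(G x) y : R)%:E).
      exact/measurable_EFinP/measurable_indic.
    have ind0 y : (0 <= (\1_(G x) y : R)%:E)%E by rewrite lee_fin.
    rewrite /h -(@integral_iid_law_density _ _ _ _ H n x (fun y => (\1_(G x) y)%:E))//.
    rewrite -measure_preimage_integral//; last exact: measurable_awgn_output.
    by apply: probability_le1; exact: mout.
  apply: (@le_trans _ _ (\int[N]_y (del%:E * h y))%E).
    apply: ge0_le_integral => //; first exact: mindQ.
      exact: emeasurable_funM.
    move=> y _; rewrite /h -!EFinM lee_fin indicE.
    case: (boolP (y \in G x)) => yG; last by rewrite !mul0r mulr0.
    rewrite !mul1r mulrCA -[leLHS]mulr1 ler_wpM2l// /del -expRD -[leLHS]expR0 ler_expR.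
    by rewrite addrC subr_ge0 ltW//; rewrite inE in yG.
  rewrite ge0_integralZl ?lee_fin ?expR_ge0//.
  by rewrite -[leRHS]mule1 lee_wpmul2l ?lee_fin ?expR_ge0.
have rhoG x : (forall k, S (tnth x k)) ->
    (N (awgn_output x @^-1` (~` G x)) <= (rho ^+ n)%:E)%E.
  move=> Sx; pose g (k : 'I_n) (z : borelR R) :=
    lam * (gam - i (tnth x k) (tnth x k + z)).
  have mg k : measurable_fun setT (g k).
    apply: measurable_funM => //; apply: measurable_funB => //.
    have madd : measurable_fun setT
      ((fun z => tnth x k + z) : borelR R -> borelR R) by exact: measurable_funD.
    exact: measurableT_comp (mi (tnth x k)) madd.
  apply: le_trans (integral_iid_law_expR_le (n := n) mg (fun k => Hrho _ (Sx k))).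
  have mnG := measurableC (mG x).
  rewrite measure_preimage_integral//; last exact: measurable_awgn_output.
  apply: ge0_le_integral => //.
  - apply/measurable_EFinP.
    have mind : measurable_fun setT (\1_(~` G x) : _ -> R).
      exact: measurable_indic.
    exact: measurableT_comp mind (measurable_awgn_output x).
  - apply/measurable_EFinP; apply: measurableT_comp; first exact: measurable_expR.
    exact: (@measurable_sum_tnth _ _ _ _ g).
  move=> z _; rewrite lee_fin indicE.
  case: (boolP (_ \in _)) => [|_]; last exact: expR_ge0.
  rewrite inE /G /= => /negP; rewrite -leNgt => Ile.
  rewrite -[leLHS]expR0 ler_expR /g -mulr_sumr mulr_ge0 ?(ltW lam0)//.
  rewrite sumrB sumr_const card_ord -[gam *+ n]mulr_natl subr_ge0.
  apply: le_trans Ile; rewrite le_eqVlt; apply/orP; left; apply/eqP.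
  by apply: eq_bigr => k _; rewrite tnth_mktuple.
(* [nx] must be total on sets in order to be iterated, so a nonmeasurable set receives the dummy
   word 0; the sets [D m] to which it is applied turn out measurable. *)
have /choice[nx nxP] : forall D : set (n.-tuple (borelR R)), exists x : n.-tuple R,
    measurable D -> (forall k, S (tnth x k)) /\
    (N (awgn_output x @^-1` D) <= \int[N]_y (\1_D y * Q y)%:E)%E.
  move=> D; have [mD|nmD] := pselect (measurable D); last first.
    by exists [tuple of nseq n 0] => /nmD.
  have mind : measurable_fun setT (fun y => (\1_D y : R)%:E).
    exact/measurable_EFinP/measurable_indic.
  have ind0 y : (0 <= (\1_D y : R)%:E)%E by rewrite lee_fin.
  have [x Sx xD] := iid_law_exists_input mq q0 avg mind ind0.
  exists x => _; split => //; rewrite measure_preimage_integral//.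
  exact: measurable_awgn_output.
(* [D m] is the union of the threshold sets of the first [m] codewords. The next codeword depends on
   the previous ones only through [D m], so the greedy choice is a plain iteration. *)
have [D [cw [D0 DS cwE]]] : exists (D : nat -> set (n.-tuple (borelR R)))
    (cw : nat -> n.-tuple R),
    [/\ D 0%N = set0, forall m, D m.+1 = D m `|` G (cw m) & forall m, cw m = nx (D m)].
  pose D m := iter m (fun D => D `|` G (nx D)) set0.
  by exists D, (fun m => nx (D m)).
have mD m : measurable (D m).
  elim: m => [|m IHm]; first by rewrite D0; exact: measurable0.
  by rewrite DS; exact: measurableU.
have QD m : (\int[N]_y (\1_(D m) y * Q y)%:E <= (m%:R * del)%:E)%E.
  elim: m => [|m IHm].
    by rewrite mul0r integral0_eq// => y _; rewrite D0 indicE memNset// mul0r.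
  rewrite -natr1 mulrDl mul1r EFinD; apply: le_trans (leeD IHm (QG (cw m))).
  rewrite -ge0_integralD//; [|exact: mindQ|exact: mindQ].
  apply: ge0_le_integral => //; first exact: mindQ.
    by apply: emeasurable_funD; exact: mindQ.
  move=> y _; rewrite -EFinD lee_fin -mulrDl ler_wpM2r// DS !indicE.
  by rewrite in_setU; case: (_ \in D m) => /=; rewrite ?lerDl ?add0r.
have Dle k m : (k <= m)%N -> D k `<=` D m.
  move=> /subnK <-; elim: (m - k)%N => [//|j IHj] y /IHj Dy.
  by rewrite addSn DS; left.
pose B m := G (cw m) `\` D m.
have mB m : measurable (B m) by exact: measurableD.
have BD k m y : (k < m)%N -> B k y -> D m y.
  by move=> km [Gy _]; apply: (Dle k.+1 m km); rewrite DS; right.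
have BnD m y : B m y -> ~ D m y by case.
have Binj k m y : B k y -> B m y -> k = m.
  move=> Bk Bm; case: (ltngtP k m) => // lt; exfalso.
    exact: (BnD m y Bm (BD k m y lt Bk)).
  exact: (BnD k y Bk (BD m k y lt Bm)).
have DB m y : D m y -> exists2 k, (k < m)%N & B k y.
  elim: m => [|m IHm]; first by rewrite D0.
  have [Dm _|nDm] := pselect (D m y).
    by have [k km Bk] := IHm Dm; exists k => //; exact: ltnW.
  by rewrite DS => -[//|Gy]; exists m.
case: M M0 => // M _.
(* The sets [B m] are disjoint but need not cover the space: outputs in none of them are decoded as
   [ord0], which accounts for the extra piece in [decE]. *)
pose dec (y : n.-tuple (borelR R)) : 'I_M.+1 :=
  if [pick m : 'I_M.+1 | `[< B m y >]] is Some m then m else ord0.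
have decB (m : 'I_M.+1) y : B m y -> dec y = m.
  rewrite /dec => Bm; case: pickP => [k /asboolP Bk|/(_ m)/asboolP//].
  by apply/val_inj; exact: Binj Bk Bm.
have decE (m : 'I_M.+1) : dec @^-1` [set m] =
    B m `|` (if m == ord0 then ~` D M.+1 else set0).
  apply/seteqP; split=> [y /= <-|y [/decB//|]]; last first.
    case: ifPn => // /eqP -> nD /=; rewrite /dec; case: pickP => // k /asboolP Bk.
    by exfalso; apply: nD; exact: BD Bk.
  rewrite {1 2}/dec; case: pickP => [k /asboolP Bk|nB]; first by left.
  by right; rewrite eqxx => /DB[k kM Bk]; have /asboolP[] := nB (Ordinal kM).
have cwP m : (forall k, S (tnth (cw m) k)) /\
    (N (awgn_output (cw m) @^-1` D m) <= \int[N]_y (\1_(D m) y * Q y)%:E)%E.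
  by rewrite cwE; exact: nxP.
unshelve eexists (@Code R A n M.+1 (fun m => cw m) dec _ _).
- by move=> m k; apply: SA; exact: (cwP m).1.
- move=> m; rewrite decE; apply: measurableU => //.
  by case: ifP => // _; exact: measurableC.
rewrite /error_probability /=.
have M0 : 0 < M.+1%:R :> R by rewrite ltr0n.
have -> : (rho ^+ n + M.+1%:R * expR (- (n%:R * gam)))%:E =
    ((M.+1%:R^-1)%:E * (M.+1%:R * (rho ^+ n + M.+1%:R * del))%:E)%E.
  by rewrite -EFinM mulKf ?lt0r_neq0.
rewrite lee_wpmul2l ?lee_fin ?invr_ge0 ?ler0n//.
apply: (@le_trans _ _ (\sum_(m < M.+1) (rho ^+ n + M.+1%:R * del)%:E)%E); last first.
  by rewrite sumEFin sumr_const card_ord -[(_ + _) *+ _]mulr_natl.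
apply: lee_sum => m _.
(* An error on message [m] means that the output misses [G (cw m)] or falls in the earlier region
   [D m]. By the choice of [cw m], the second event has probability at most the reference mass of
   [D m], hence at most [m * del]. *)
apply: (@le_trans _ _ (N (awgn_output (cw m) @^-1` (~` G (cw m)) `|`
    awgn_output (cw m) @^-1` (D m)))).
  apply: le_measure; rewrite ?inE.
  - rewrite -[X in measurable X]/(~` (awgn_output (cw m) @^-1` (dec @^-1` [set m]))).
    apply: measurableC; apply: mout; rewrite decE; apply: measurableU => //.
    by case: ifP => // _; exact: measurableC.
  - by apply: measurableU; apply: mout => //; exact: measurableC.
  move=> z /= decm; have [Dz|nDz] := pselect (D m (awgn_output (cw m) z)); first by right.
  by left => Gz; apply: decm; exact: decB.
apply: le_trans (measureU2 _ _ _) _; [exact: mout (measurableC (mG _))|exact: mout|].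
rewrite EFinD; apply: leeD; first by apply: rhoG; exact: (cwP m).1.
apply: le_trans (cwP m).2 _; apply: le_trans (QD m) _.
by rewrite lee_fin ler_wpM2r ?expR_ge0// ler_nat ltnW.
Qed.

Lemma achievable_of_information_density (R : realType) (nu A r : R) (S : set R)
    (q : borelR R -> R) (i : R -> borelR R -> R) (lam gam rho : R) :
  let P := normal_prob 0 (Num.sqrt nu) in
  has_information_density P q i -> (forall x, S x -> `|x| <= A) ->
  (forall F : borelR R -> \bar R, measurable_fun setT F ->
     (forall y, 0 <= F y)%E ->
     exists2 x, S x & (\int[P]_z F (x + z)%R <= \int[P]_y (F y * (q y)%:E))%E) ->
  0 < lam -> 0 <= rho < 1 ->
  (forall x, S x ->
     (\int[P]_z (expR (lam * (gam - i x (x + z)%R)))%:E <= rho%:E)%E) ->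
  0 <= r < gam -> achievable A nu r.
Proof.
move=> P H SA avg lam0 /andP[rho0 rho1] Hrho /andP[r0 rgam].
have M0 n : (0 < message_count r n)%N.
  by rewrite Num.Theory.truncn_gt0 -[leLHS]expR0 ler_expR mulr_ge0.
have H' n : exists c : Defs.code A n (message_count r n), (error_probability nu c
    <= (rho ^+ n + (message_count r n)%:R * expR (- (n%:R * gam)))%:E)%E.
  exact: exists_code H SA avg lam0 Hrho (M0 n).
pose c n := sval (cid (H' n)); have cP n := svalP (cid (H' n)).
exists c.
pose s n := rho ^+ n + expR (- (gam - r)) ^+ n.
have cvgs : s @ \oo --> (0 : R).
  rewrite -[X in _ --> X](addr0 0).
  apply: cvgD; apply: cvg_expr; first by rewrite ger0_norm.
  by rewrite ger0_norm ?expR_ge0// -expR0 ltr_expR oppr_lt0 subr_gt0.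
have cvgs' : (s n)%:E @[n --> \oo] --> 0%E.
  by apply: cvg_EFin; [exact: nearW|exact: cvgs].
apply: (squeeze_cvge _ (cvg_cst 0%E) cvgs'); apply: nearW => n; apply/andP; split.
  rewrite /error_probability mule_ge0 ?lee_fin ?invr_ge0 ?ler0n//.
  by apply: sume_ge0 => m _; exact: measure_ge0.
apply: le_trans (cP n) _; rewrite lee_fin lerD2l -expRM_natl mulrN mulrBr opprB expRD.
rewrite ler_wpM2r ?expR_ge0//.
by rewrite -Num.Theory.truncn_ge_nat ?expR_ge0.
Qed.

(** * Gaussian integrals *)

Lemma normal_pdf_sqrt (R : realType) (nu m y : R) : 0 < nu ->
  normal_pdf m (Num.sqrt nu) y =
    (Num.sqrt (2 * pi * nu))^-1 * expR (- (y - m) ^+ 2 / (2 * nu)).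
Proof.
move=> nu0; rewrite normal_pdfE ?gt_eqF ?sqrtr_gt0//.
rewrite /normal_peak /normal_fun sqr_sqrtr ?(ltW nu0)//.
congr (_^-1 * expR (_ / _)); last by rewrite mulr_natl.
by congr Num.sqrt; ring.
Qed.

(** The one-dimensional Cameron-Martin formula: the exponential is the ratio of the Gaussian
    densities centred at [x] and at 0. *)
Lemma normal_prob_shift (R : realType) (nu x : R) (F : borelR R -> \bar R) :
  0 < nu -> measurable_fun setT F -> (forall y, 0 <= F y)%E ->
  (\int[normal_prob 0 (Num.sqrt nu)]_z F (x + z)%R =
   \int[normal_prob 0 (Num.sqrt nu)]_y (F y * (expR ((x * y - x ^+ 2 / 2) / nu))%:E))%E.
Proof.
move=> nu0 mF F0.
have madd : measurable_fun setT ((fun z => x + z) : borelR R -> borelR R).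
  exact: measurable_funD.
have mpdf m : measurable_fun setT (fun y : borelR R => (normal_pdf m (Num.sqrt nu) y)%:E).
  by apply/measurable_EFinP; exact: measurable_normal_pdf.
rewrite (@integral_normal_prob _ 0 _ (fun z => F (x + z)))//; last first.
  exact: measurableT_comp mF madd.
rewrite integral_normal_prob//; first last.
- by move=> y; rewrite mule_ge0// lee_fin expR_ge0.
- apply: emeasurable_funM => //; apply/measurable_EFinP.
  apply: measurableT_comp; first exact: measurable_expR.
  by apply: measurable_funM => //; apply: measurable_funB => //; exact: measurable_funM.
rewrite -[RHS](ge0_integral_shift x); first last.
- by move=> y; rewrite !mule_ge0 ?lee_fin ?expR_ge0 ?normal_pdf_ge0.
- apply: emeasurable_funM => //; apply: emeasurable_funM => //; apply/measurable_EFinP.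
  apply: measurableT_comp; first exact: measurable_expR.
  by apply: measurable_funM => //; apply: measurable_funB => //; exact: measurable_funM.
apply: eq_integral => z _; rewrite -muleA; congr (_ * _)%E.
rewrite -EFinM !normal_pdf_sqrt// mulrCA -expRD; congr (_ * expR _)%:E.
by field; rewrite gt_eqF.
Qed.

(** Applied to the constant 1 with shift [b * nu], [normal_prob_shift] says that the likelihood
    ratio [g] integrates to 1, and [expR (b * z)] is a constant multiple of [g]. *)
Lemma normal_prob_mgf (R : realType) (nu b : R) : 0 < nu ->
  (\int[normal_prob 0 (Num.sqrt nu)]_z (expR (b * z))%:E
   = (expR (b ^+ 2 * nu / 2))%:E)%E.
Proof.
move=> nu0; pose g y := (expR ((b * nu * y - (b * nu) ^+ 2 / 2) / nu))%:E.
have H : (\int[normal_prob 0 (Num.sqrt nu)]_y g y = 1)%E.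
  have := @normal_prob_shift R nu (b * nu) (cst 1%E) nu0
    (measurable_cst _) (fun=> lee01).
  rewrite (eq_integral (cst 1%E))// integral_cst// mul1e.
  rewrite -[X in _ -> _ = X]/(1%E) -[X in X = _ -> _]/(normal_prob 0 (Num.sqrt nu) setT).
  rewrite probability_setT => ->.
  by apply: eq_integral => y _; rewrite mul1e.
have E y : (expR (b * y))%:E = ((expR (b ^+ 2 * nu / 2))%:E * g y)%E.
  rewrite -EFinM -expRD; congr (expR _)%:E.
  by field; rewrite gt_eqF.
under eq_integral do rewrite E.
rewrite ge0_integralZl//=.
- by rewrite H mule1.
- apply/measurable_EFinP.
  apply: measurableT_comp; first exact: measurable_expR.
  by apply: measurable_funM => //; apply: measurable_funB => //; exact: measurable_funM.
- by move=> y _; rewrite lee_fin expR_ge0.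
Qed.

(** The integrand times the noise density is a multiple of the Gaussian density of variance
    [nu / (1 + b)]; the value is the ratio of the two normalizations. *)
Lemma normal_prob_quadratic (R : realType) (nu b : R) : 0 < nu -> 0 < 1 + b ->
  (\int[normal_prob 0 (Num.sqrt nu)]_z (expR (- b * (z ^+ 2 / (2 * nu))))%:E
   = ((Num.sqrt (1 + b))^-1)%:E)%E.
Proof.
move=> nu0 b1; have nub0 : 0 < nu / (1 + b) by rewrite divr_gt0.
have mexp : measurable_fun setT
    (fun z : borelR R => (expR (- b * (z ^+ 2 / (2 * nu))))%:E).
  apply/measurable_EFinP; apply: measurableT_comp; first exact: measurable_expR.
  by apply: measurable_funM => //; apply: measurable_funM => //; exact: measurable_funX.
rewrite integral_normal_prob//.
have E (z : R) : ((expR (- b * (z ^+ 2 / (2 * nu))))%:E *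
    (normal_pdf 0 (Num.sqrt nu) z)%:E =
  ((Num.sqrt (1 + b))^-1)%:E * (normal_pdf 0 (Num.sqrt (nu / (1 + b))) z)%:E)%E.
  rewrite -!EFinM !normal_pdf_sqrt//; congr _%:E.
  rewrite [RHS]mulrA -invfM -sqrtrM ?(ltW b1)//.
  rewrite (_ : (1 + b) * (2 * pi * (nu / (1 + b))) = 2 * pi * nu); last first.
    by field; rewrite gt_eqF.
  rewrite mulrCA -expRD; congr (_ * expR _).
  by field; rewrite !gt_eqF.
under eq_integral do rewrite E.
rewrite ge0_integralZl//.
- by rewrite integral_normal_pdf mule1.
- by apply/measurable_EFinP; exact: measurable_normal_pdf.
- by move=> y _; rewrite lee_fin normal_pdf_ge0.
Qed.

(** * Capacity bounds from thresholds, and the quadratic Chernoff bound *)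

(** A single message is never decoded wrongly. This settles the negative targets in
    [capacity_ge]. *)
Lemma achievable0 (R : realType) (A nu : R) : 0 <= A -> achievable A nu 0.
Proof.
move=> A0.
have E n : message_count (0 : R) n = 1%N.
  by rewrite /message_count mulr0 expR0; exact: Num.Theory.truncn1.
have M0 n : (0 < message_count (0 : R) n)%N by rewrite E.
have M1 n (m m' : 'I_(message_count (0 : R) n)) : m = m'.
  have v0 (k : 'I_(message_count (0 : R) n)) : nat_of_ord k = 0%N.
    by have := leq_trans (ltn_ord k) (eq_leq (E n)); rewrite ltnS leqn0 => /eqP.
  by apply/val_inj; rewrite /= !v0.
unshelve eexists.
  move=> n; unshelve eapply (@Code R A n _ (fun=> [tuple of nseq n 0]) (fun=> Ordinal (M0 n))).
  - by move=> m i; rewrite tnth_nseq normr0.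
  - move=> m; rewrite (_ : _ @^-1` _ = setT); first exact: measurableT.
    by apply/seteqP; split => // y _; exact: M1.
apply: cvg_near_cst; apply: nearW => n.
rewrite /error_probability big1 ?mule0// => m _.
rewrite (_ : [set _ | _] = set0) ?measure0//.
by apply/seteqP; split => // z /=; apply; exact: M1.
Qed.

Lemma capacity_le (R : realType) (A nu D : R) :
  (forall r gam, achievable A nu r -> D < gam -> r <= gam) ->
  (capacity A nu <= D%:E)%E.
Proof.
move=> H; apply: ge_ereal_sup => _ [r ar <-]; rewrite lee_fin.
by apply/ler_addgt0Pr => e e0; apply: H => //; rewrite ltrDl.
Qed.

Lemma capacity_ge (R : realType) (A nu D : R) : 0 <= A ->
  (forall r gam, 0 <= r < gam -> gam < D -> achievable A nu r) ->
  (D%:E <= capacity A nu)%E.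
Proof.
move=> A0 H; apply/lee_subgt0Pr => e e0; rewrite -EFinB.
have [De0|De0] := leP 0 (D - e).
  apply: ereal_sup_ubound; exists (D - e) => //.
  apply: (H _ (D - e / 2)); first by apply/andP; split => //; lra.
  by lra.
apply: (@le_trans _ _ 0%E); first by rewrite lee_fin ltW.
by apply: ereal_sup_ubound; exists 0 => //; exact: achievable0.
Qed.

Lemma inv_sqrt_le_expR (R : realType) (b : R) : 0 < 1 + b ->
  (Num.sqrt (1 + b))^-1 <= expR (- (b / (1 + b)) / 2).
Proof.
move=> b1; rewrite -sqrtrV ?(ltW b1)// -[leRHS]ger0_norm ?expR_ge0//.
rewrite -sqrtr_sqr ler_sqrt ?sqr_ge0// -expRM_natl mulrC divfK//.
apply: le_trans (expR_ge1Dx _); rewrite le_eqVlt; apply/orP; left; apply/eqP.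
by field; rewrite gt_eqF.
Qed.

(** Since [z ^+ 2 / (2 * nu)] has mean 1/2, the bracket has negative mean, and a small [lam] brings
    the exponential moment below 1. The sign of [be] is left free: it is nonnegative in the
    small-noise converse and -1 in the direct part. *)
Lemma quadratic_chernoff (R : realType) (nu c be : R) : 0 < nu -> `|be| <= 1 ->
  c < be / 2 ->
  exists lam rho : R, [/\ 0 < lam, 0 <= rho < 1 &
    (\int[normal_prob 0 (Num.sqrt nu)]_z
       (expR (lam * (c - be * (z ^+ 2 / (2 * nu)))))%:E <= rho%:E)%E].
Proof.
move=> nu0 be1 cbe; pose d := be / 2 - c; have d0 : 0 < d by rewrite /d; lra.
(* [lam <= 1 / 2] keeps [1 + b] away from 0; [lam <= d / 2] makes the second-order term
   [lam * be ^+ 2 * u / 2], which is at most [lam], smaller than the gap [d]. *)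
pose lam := d / (2 + 2 * d); have lam0 : 0 < lam by rewrite divr_gt0//; lra.
have d2 : 0 < 2 + 2 * d by lra.
have lamE : lam * (2 + 2 * d) = d by rewrite /lam mulfVK ?gt_eqF.
have lamd : lam <= d / 2 by nra.
have lamh : lam <= 1 / 2 by nra.
move: be1; rewrite ler_norml => /andP[be1 be2].
pose b := lam * be.
have b1 : 1 / 2 <= 1 + b by rewrite /b; nra.
have b0 : 0 < 1 + b by lra.
exists lam, (expR (lam * c) * expR (- (b / (1 + b)) / 2)); split => //.
  rewrite mulr_ge0 ?expR_ge0//= -expRD -[ltRHS]expR0 ltr_expR.
  pose u := (1 + b)^-1.
  have u0 : 0 < u by rewrite invr_gt0.
  have ub : u * (1 + b) = 1 by rewrite /u mulVf ?gt_eqF.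
  have u2 : u <= 2 by nra.
  rewrite -/u; have -> : lam * c + - (b * u) / 2 = lam * (c - be * u / 2).
    by rewrite /b; ring.
  rewrite pmulr_rlt0//.
  have -> : be * u = be - lam * (be ^+ 2 * u).
    have h : be * u * (1 + lam * be) = be by rewrite -mulrA ub mulr1.
    by apply/eqP; rewrite eq_sym subr_eq -[X in X == _]h; apply/eqP; ring.
  have : be ^+ 2 * u <= 2 by nra.
  have : 0 <= be ^+ 2 * u by rewrite mulr_ge0 ?sqr_ge0 ?ltW.
  by rewrite /d in lamd; nra.
have E (z : R) : (expR (lam * (c - be * (z ^+ 2 / (2 * nu)))))%:E =
    ((expR (lam * c))%:E * (expR (- b * (z ^+ 2 / (2 * nu))))%:E)%E.
  by rewrite -EFinM -expRD; congr (expR _)%:E; rewrite /b; ring.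
under eq_integral do rewrite E.
rewrite ge0_integralZl//=.
- rewrite normal_prob_quadratic// -EFinM lee_fin ler_wpM2l ?expR_ge0//.
  exact: inv_sqrt_le_expR.
- apply/measurable_EFinP; apply: measurableT_comp; first exact: measurable_expR.
  by apply: measurable_funM => //; apply: measurable_funM => //; exact: measurable_funX.
Qed.

(** Logarithm of the Cameron-Martin ratio over [q]. Here [q] is a density relative to the noise law,
    so a Lebesgue density [g] enters as [g] divided by the noise density. *)
Definition gaussian_information (R : realType) (nu : R) (q : borelR R -> R)
  (x : R) (y : borelR R) : R := (x * y - x ^+ 2 / 2) / nu - ln (q y).

Lemma gaussian_information_density (R : realType) (nu : R) (q : borelR R -> R) :
  0 < nu -> measurable_fun setT q -> (forall y, 0 < q y) ->
  has_information_density (normal_prob 0 (Num.sqrt nu)) q (gaussian_information nu q).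
Proof.
move=> nu0 mq q0; split => //.
- by move=> y; exact: ltW.
- move=> x; apply: measurable_funB.
    by apply: measurable_funM => //; apply: measurable_funB => //; exact: measurable_funM.
  exact: measurableT_comp (@measurable_ln R) mq.
move=> x F mF F0; rewrite normal_prob_shift//; apply: eq_integral => y _.
congr (_ * _%:E)%E; rewrite /gaussian_information expRD expRN lnK ?posrE//.
by rewrite mulrCA mulfV ?mulr1// gt_eqF.
Qed.

(** Otherwise [h - I] is positive on [D] and integrates to 0 there, which makes [D] a null set. *)
Lemma exists_le_average d (T : measurableType d) (R : realType)
    (mu : {measure set T -> \bar R}) (D : set T) (m I : R) (h : T -> \bar R) :
  measurable D -> mu D = m%:E -> 0 < m -> measurable_fun setT h ->
  (forall x, 0 <= h x)%E -> 0 <= I -> (\int[mu]_(x in D) h x <= (m * I)%:E)%E ->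
  exists2 x, D x & (h x <= I%:E)%E.
Proof.
move=> mD muD m0 mh h0 I0 hI; apply: contrapT => nex.
have hlt x : D x -> (I%:E < h x)%E.
  by move=> Dx; rewrite ltNge; apply/negP => le; apply: nex; exists x.
have mhI : measurable_fun D (fun x => h x - I%:E)%E.
  by apply: measurable_funTS; exact: emeasurable_funB.
have hI0 x : D x -> (0 <= h x - I%:E)%E.
  by move=> Dx; rewrite sube_ge0 ?orbT// ltW// hlt.
have : (\int[mu]_(x in D) h x = \int[mu]_(x in D) (h x - I%:E) + (m * I)%:E)%E.
  rewrite mulrC EFinM -muD -integral_cst// -ge0_integralD//.
  by apply: eq_integral => x _; exact/esym/subeK.
move=> hE; rewrite {}hE in hI.
have int0 : (\int[mu]_(x in D) (h x - I%:E) = 0)%E.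
  apply/eqP; rewrite eq_le integral_ge0// andbT.
  by move: hI; rewrite -[leRHS]add0e leeD2rE.
have /(ae_eq_integral_abs mu mD mhI).1 : (\int[mu]_(x in D) `|h x - I%:E| = 0)%E.
  by rewrite -int0; apply: eq_integral => x /[!inE] Dx; rewrite gee0_abs// hI0.
move=> [N [mN N0 subN]].
have : (mu D <= mu N)%E.
  apply: le_measure; rewrite ?inE// => x Dx; apply: subN => /(_ Dx) /= h0'.
  by have := hlt x Dx; rewrite -sube_gt0 h0' ltxx.
by rewrite N0 muD lee_fin leNgt m0.
Qed.

(** * Small noise *)

Lemma normal_pdf_sqrt_gt0 (R : realType) (nu m y : R) : 0 < nu ->
  0 < normal_pdf m (Num.sqrt nu) y.
Proof.
move=> nu0; rewrite normal_pdf_sqrt// mulr_gt0 ?expR_gt0// invr_gt0 sqrtr_gt0.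
by rewrite !mulr_gt0 ?pi_gt0.
Qed.

Lemma measurable_normal_pdf_inv (R : realType) (nu : R) : 0 < nu ->
  measurable_fun setT (fun y : borelR R => (normal_pdf 0 (Num.sqrt nu) y)^-1).
Proof.
move=> nu0; rewrite (_ : (fun y => _) =
  (fun y : borelR R => Num.sqrt (2 * pi * nu) * expR (y ^+ 2 / (2 * nu)))).
  apply: measurable_funM => //; apply: measurableT_comp; first exact: measurable_expR.
  by apply: measurable_funM => //; exact: measurable_funX.
apply/funext => y; rewrite normal_pdf_sqrt// invfM invrK -expRN; congr (_ * expR _).
by field; rewrite gt_eqF.
Qed.

Lemma integral_gaussian_kernel (R : realType) (t m : R) : 0 < t ->
  (\int[lebesgue_measure]_y (expR (- (y - m) ^+ 2 / (2 * t)))%:E =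
    (Num.sqrt (2 * pi * t))%:E)%E.
Proof.
move=> t0; have s0 : 0 < Num.sqrt (2 * pi * t).
  by rewrite sqrtr_gt0 !mulr_gt0 ?pi_gt0.
have E (y : R) : (expR (- (y - m) ^+ 2 / (2 * t)))%:E =
    ((Num.sqrt (2 * pi * t))%:E * (normal_pdf m (Num.sqrt t) y)%:E)%E.
  by rewrite -EFinM normal_pdf_sqrt// mulrA mulfV ?mul1r// gt_eqF.
under eq_integral do rewrite E.
rewrite ge0_integralZl//.
- by rewrite integral_normal_pdf mule1.
- by apply/measurable_EFinP; exact: measurable_normal_pdf.
- by move=> y _; rewrite lee_fin normal_pdf_ge0.
Qed.

(** The factors of the noise density at [x + z] cancel, leaving the log-density of the noise at [z]
    minus that of the reference at the output. *)
Lemma gaussian_information_ratio (R : realType) (nu : R) (g : borelR R -> R) (x z : R) :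
  0 < nu -> 0 < g (x + z) ->
  gaussian_information nu (fun y => g y / normal_pdf 0 (Num.sqrt nu) y) x (x + z) =
  - (z ^+ 2 / (2 * nu)) - ln (Num.sqrt (2 * pi * nu)) - ln (g (x + z)).
Proof.
move=> nu0 g0; rewrite /gaussian_information.
have s0 : 0 < Num.sqrt (2 * pi * nu) by rewrite sqrtr_gt0 !mulr_gt0 ?pi_gt0.
rewrite lnM ?posrE ?invr_gt0 ?normal_pdf_sqrt_gt0//.
rewrite lnV ?posrE ?normal_pdf_sqrt_gt0// normal_pdf_sqrt//.
rewrite lnM ?posrE ?invr_gt0 ?expR_gt0// lnV ?posrE// expRK.
by field; rewrite gt_eqF.
Qed.

Lemma lebesgue_measure_symmetric_itv (R : realType) (A : R) : 0 < A ->
  lebesgue_measure (`[- A, A]%classic : set (borelR R)) = (2 * A)%:E.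
Proof.
move=> A0; rewrite lebesgue_measure_itv/= lte_fin (_ : - A < A); last by lra.
by rewrite -EFinB; congr _%:E; ring.
Qed.

(* The reference output law is uniform on [-A, A] with Gaussian tails of variance [t];
   the wider tails make the information density a function of the noise only. *)
Lemma capacity_le_gaussian_tails (R : realType) (A nu t : R) :
  0 < A -> 0 < nu -> nu <= t ->
  (capacity A nu <=
    (ln (2 * A + 2 * Num.sqrt (2 * pi * t)) - ln (Num.sqrt (2 * pi * nu))
     - 2^-1 + nu / t / 2)%:E)%E.
Proof.
move=> A0 nu0 nut; have t0 : 0 < t by exact: lt_le_trans nut.
set s := Num.sqrt (2 * pi * nu).
have s0 : 0 < s by rewrite sqrtr_gt0 !mulr_gt0 ?pi_gt0.
set st := Num.sqrt (2 * pi * t).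
have st0 : 0 < st by rewrite sqrtr_gt0 !mulr_gt0 ?pi_gt0.
(* Normalization: both Gaussian kernels are kept on the whole line instead of being cut to
   half-tails, which only changes the constant in the error term. *)
set G := 2 * A + 2 * st.
have G0 : 0 < G by rewrite /G; lra.
pose k1 (y : borelR R) : R := \1_(`[- A, A]%classic : set (borelR R)) y.
pose k2 (y : borelR R) : R := expR (- (y - A) ^+ 2 / (2 * t)).
pose k3 (y : borelR R) : R := expR (- (y - (- A)) ^+ 2 / (2 * t)).
pose g (y : borelR R) : R := (k1 y + (k2 y + k3 y)) / G.
have mk1 : measurable_fun setT k1 by exact: measurable_indic.
have mk m : measurable_fun setT (fun y : borelR R => expR (- (y - m) ^+ 2 / (2 * t)) : R).
  apply: measurableT_comp; first exact: measurable_expR.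
  apply: measurable_funM => //; apply: measurableT_comp => //.
  by apply: measurable_funX; exact: measurable_funB.
have mk2 : measurable_fun setT k2 by exact: mk.
have mk3 : measurable_fun setT k3 by exact: mk.
have k10 y : 0 <= k1 y by [].
have k20 y : 0 < k2 y by exact: expR_gt0.
have k30 y : 0 < k3 y by exact: expR_gt0.
have g0 y : 0 < g y by rewrite divr_gt0// ltr_wpDl// addr_gt0.
have mg : measurable_fun setT g.
  by apply: measurable_funM => //; do 2 apply: measurable_funD => //.
pose q (y : borelR R) : R := g y / normal_pdf 0 (Num.sqrt nu) y.
have p0 y : 0 < normal_pdf 0 (Num.sqrt nu) y by exact: normal_pdf_sqrt_gt0.
have mq : measurable_fun setT q.
  by apply: measurable_funM => //; exact: measurable_normal_pdf_inv.
have q0 y : 0 < q y by rewrite divr_gt0.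
have q1 : (\int[normal_prob 0 (Num.sqrt nu)]_y (q y)%:E <= 1)%E.
  rewrite integral_normal_prob//; last 2 first.
  - exact/measurable_EFinP.
  - by move=> y; rewrite lee_fin ltW.
  rewrite (eq_integral (fun y => (G^-1)%:E * ((k1 y)%:E + ((k2 y)%:E + (k3 y)%:E)))%E); last first.
    by move=> y _; rewrite -!EFinD -!EFinM /q mulfVK ?gt_eqF// mulrC.
  have m23 : measurable_fun setT (fun y => (k2 y)%:E + (k3 y)%:E)%E.
    by apply/measurable_EFinP; exact: measurable_funD.
  have k23 y : (0 <= (k2 y)%:E + (k3 y)%:E)%E.
    by rewrite -EFinD lee_fin addr_ge0// ltW.
  rewrite ge0_integralZl//; first last.
  - by rewrite lee_fin invr_ge0 ltW.
  - by move=> y _; rewrite adde_ge0// lee_fin.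
  - by apply: emeasurable_funD => //; exact/measurable_EFinP.
  rewrite ge0_integralD//; last 2 first.
  - by move=> y _; rewrite lee_fin.
  - exact/measurable_EFinP.
  rewrite ge0_integralD//; last 4 first.
  - by move=> y _; rewrite lee_fin ltW.
  - exact/measurable_EFinP.
  - by move=> y _; rewrite lee_fin ltW.
  - exact/measurable_EFinP.
  rewrite !integral_gaussian_kernel// integral_indic// setIT.
  rewrite [X in (_ * (X + _))%E](_ : _ = (2 * A)%:E); last first.
    exact: lebesgue_measure_symmetric_itv.
  rewrite -/st -!EFinD -EFinM lee_fin (_ : 2 * A + (st + st) = G).
    by rewrite mulVf// gt_eqF.
  by rewrite /G; ring.
(* An output outside [-A, A] overshoots the nearer end by at most [|z|], because [x] lies inside; on
   the interval the indicator alone is enough. *)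
have gge x z : `|x| <= A -> expR (- (z ^+ 2 / (2 * t))) / G <= g (x + z).
  rewrite ler_norml => /andP[x1 x2]; rewrite /g ler_wpM2r ?invr_ge0 ?(ltW G0)//.
  have [zle|zgt] := leP (x + z) A; last first.
    rewrite ler_wpDl// ler_wpDr ?(ltW (k30 _))// /k2 ler_expR mulNr lerN2.
    by rewrite ler_wpM2r ?invr_ge0 ?mulr_ge0 ?(ltW t0)// ler_sqr ?nnegrE; lra.
  have [zge|zlt] := leP (- A) (x + z); last first.
    rewrite ler_wpDl// ler_wpDl ?(ltW (k20 _))// /k3 ler_expR mulNr lerN2.
    by rewrite ler_wpM2r ?invr_ge0 ?mulr_ge0 ?(ltW t0)// -sqrrN -[leRHS]sqrrN ler_sqr ?nnegrE; lra.
  have k11 : k1 (x + z) = 1.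
    by rewrite /k1 indicE mem_set// /mkset in_itv/= zge zle.
  have k230 : 0 <= k2 (x + z) + k3 (x + z) by apply: addr_ge0; exact: ltW.
  apply: ler_wpDr; first exact: k230.
  rewrite k11 -[leRHS]expR0 ler_expR oppr_le0 divr_ge0 ?sqr_ge0//.
  by rewrite mulr_ge0// ltW.
apply: capacity_le => r gam ar Dgam.
(* By [gge], the information density minus [gam] is at most [c - be * (z ^+ 2 / (2 * nu))]: the tail
   term [z ^+ 2 / (2 * t)] takes the fraction [nu / t] off the noise exponent. *)
pose c := ln G - ln s - gam; pose be := 1 - nu / t.
have nut1 : 0 < nu / t <= 1 by rewrite divr_gt0//= ler_pdivrMr// mul1r.
have be1 : `|be| <= 1.
  by rewrite ler_norml /be; move: nut1 => /andP[? ?]; apply/andP; split; lra.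
have cbe : c < be / 2 by rewrite /c /be; move: Dgam; rewrite -/s -/st -/G; lra.
have [lam [rho [lam0 rho1 rhoP]]] := quadratic_chernoff nu0 be1 cbe.
have [_ _ mi _] := gaussian_information_density nu0 mq q0.
apply: (achievable_le (gaussian_information_density nu0 mq q0) q1 lam0 rho1 _ ar).
move=> x xA; apply: le_trans rhoP; apply: ge0_le_integral => //.
- apply/measurable_EFinP; apply: measurableT_comp; first exact: measurable_expR.
  apply: measurable_funM => //; apply: measurable_funB => //.
  have madd : measurable_fun setT ((fun z => x + z) : borelR R -> borelR R).
    exact: measurable_funD.
  exact: measurableT_comp (mi x) madd.
- apply/measurable_EFinP; apply: measurableT_comp; first exact: measurable_expR.
  apply: measurable_funM => //; apply: measurable_funB => //.
  by apply: measurable_funM => //; apply: measurable_funM => //; exact: measurable_funX.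
move=> z _; rewrite lee_fin ler_expR ler_wpM2l ?(ltW lam0)// gaussian_information_ratio//.
have : ln (expR (- (z ^+ 2 / (2 * t))) / G) <= ln (g (x + z)).
  by rewrite ler_ln ?posrE ?gge// divr_gt0 ?expR_gt0.
rewrite lnM ?posrE ?expR_gt0 ?invr_gt0// lnV ?posrE// expRK => lng.
rewrite -/s /c /be mulrBl mul1r.
rewrite (_ : nu / t * (z ^+ 2 / (2 * nu)) = z ^+ 2 / (2 * t)); first by lra.
by field; rewrite !gt_eqF.
Qed.

(** By Tonelli and translation invariance, integrating the left side over all real [x] gives the
    Lebesgue integral of [F]. Its average over [-A, A] is then at most that integral divided by
    [2 * A], and some input does not exceed the average. *)
Lemma exists_input_le_uniform (R : realType) (A nu : R) (F : borelR R -> \bar R) :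
  0 < A -> 0 < nu -> measurable_fun setT F -> (forall y, 0 <= F y)%E ->
  exists2 x, `[- A, A]%classic x &
    (\int[normal_prob 0 (Num.sqrt nu)]_z F (x + z)%R <=
     \int[normal_prob 0 (Num.sqrt nu)]_y
       (F y * ((2 * A)^-1 / normal_pdf 0 (Num.sqrt nu) y)%:E))%E.
Proof.
move=> A0 nu0 mF F0; set P := normal_prob 0 (Num.sqrt nu).
have A20 : 0 < 2 * A by lra.
have p0 y : 0 < normal_pdf 0 (Num.sqrt nu) y by exact: normal_pdf_sqrt_gt0.
have -> : (\int[P]_y (F y * ((2 * A)^-1 / normal_pdf 0 (Num.sqrt nu) y)%:E) =
   ((2 * A)^-1)%:E * \int[lebesgue_measure]_y F y)%E.
  rewrite integral_normal_prob//; first last.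
  - by move=> y; rewrite mule_ge0// lee_fin divr_ge0 ?invr_ge0 ?ltW.
  - apply: emeasurable_funM => //; apply/measurable_EFinP.
    by apply: measurable_funM => //; exact: measurable_normal_pdf_inv.
  rewrite -ge0_integralZl// ?lee_fin ?invr_ge0 ?(ltW A20)//.
  apply: eq_integral => y _; rewrite -muleA -EFinM divfK ?gt_eqF// muleC.
  by [].
have : (0 <= \int[lebesgue_measure]_y F y)%E by exact: integral_ge0.
case EF : (\int[lebesgue_measure]_y F y)%E => [f| |] // f0; last first.
  (* When [F] has infinite integral the bound is infinite and any admissible input will do. *)
  exists 0; first by rewrite /= in_itv/= oppr_le0 ltW.
  by rewrite gt0_muley ?leey// lte_fin invr_gt0.
pose Fa (xz : borelR R * borelR R) := F (xz.1 + xz.2)%R.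
have mFa : measurable_fun setT Fa.
  by apply: (measurableT_comp mF); exact: measurable_funD.
have Fa0 xz : (0 <= Fa xz)%E by exact: F0.
have swap := fubini_tonelli (m1 := lebesgue_measure) (m2 := P) Fa mFa Fa0.
pose h (x : borelR R) := (\int[P]_z F (x + z)%R)%E.
have mh : measurable_fun setT h.
  exact: (measurable_fun_fubini_tonelli_F (m2 := P) _ mFa).
have h0 x : (0 <= h x)%E by exact: integral_ge0.
have hT : (\int[lebesgue_measure]_x h x = f%:E)%E.
  rewrite -[LHS]/(\int[lebesgue_measure]_x \int[P]_z Fa (x, z))%E [LHS]swap.
  rewrite (eq_integral (cst f%:E)); last first.
    move=> z _; rewrite /fubini_G /Fa /= -[RHS]EF.
    rewrite -[RHS](ge0_integral_shift z)//.
    by apply: eq_integral => x _; rewrite addrC.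
  by rewrite integral_cst// -[RHS]mule1; congr (_ * _)%E; exact: probability_setT.
have f0' : 0 <= f by rewrite -lee_fin.
have mD : measurable (`[- A, A]%classic : set (borelR R)) by exact: measurable_itv.
have muD := lebesgue_measure_symmetric_itv A0.
have I0 : 0 <= (2 * A)^-1 * f by rewrite mulr_ge0// invr_ge0 ltW.
have [] := @exists_le_average _ _ _ lebesgue_measure _ _ _ h mD muD A20 mh h0 I0.
  rewrite mulVKf ?gt_eqF// -hT; apply: ge0_subset_integral => //.
by move=> x xA hx; exists x => //; rewrite -EFinM.
Qed.

Lemma capacity_ge_uniform (R : realType) (A nu : R) : 0 < A -> 0 < nu ->
  ((ln (2 * A) - ln (Num.sqrt (2 * pi * nu)) - 2^-1)%:E <= capacity A nu)%E.
Proof.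
move=> A0 nu0; apply: capacity_ge; first exact: ltW.
have A20 : 0 < 2 * A by lra.
set s := Num.sqrt (2 * pi * nu).
have s0 : 0 < s by rewrite sqrtr_gt0 !mulr_gt0 ?pi_gt0.
have p0 y : 0 < normal_pdf 0 (Num.sqrt nu) y by exact: normal_pdf_sqrt_gt0.
pose q (y : borelR R) : R := (2 * A)^-1 / normal_pdf 0 (Num.sqrt nu) y.
have q0 y : 0 < q y by rewrite divr_gt0// invr_gt0.
have mq : measurable_fun setT q.
  by apply: measurable_funM => //; exact: measurable_normal_pdf_inv.
move=> r gam r0gam gamD.
(* With a constant reference density, [gam] minus the information density equals
   [c + z ^+ 2 / (2 * nu)], which is the case [be = -1]. *)
pose c := gam - (ln (2 * A) - ln s).
have cbe : c < -1 / 2 by rewrite /c /s; lra.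
have be1 : `|-1 : R| <= 1 by rewrite normrN1.
have [lam [rho [lam0 rho1 rhoP]]] := quadratic_chernoff nu0 be1 cbe.
apply: (achievable_of_information_density (S := `[- A, A]%classic)
  (gaussian_information_density nu0 mq q0) _ _ lam0 rho1 _ r0gam).
- by move=> x; rewrite /= in_itv/= ler_norml.
- by move=> F mF F0; exact: exists_input_le_uniform.
move=> x _; apply: le_trans rhoP; rewrite le_eqVlt; apply/orP; left; apply/eqP.
apply: eq_integral => z _; congr (expR (_ * _))%:E.
rewrite (gaussian_information_ratio (g := fun=> (2 * A)^-1))// ?invr_gt0//.
by rewrite lnV ?posrE// -/s /c; ring.
Qed.

(** * From explicit bounds to the small-noise expansion *)

Lemma eqaddO_near (R : realType) (F : filter_on R) (f g e : R -> R) (K : R) :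
  (\forall x \near F, `|f x - g x| <= K * `|e x|) -> f = g +O_F e.
Proof.
move=> H; apply/eqaddOP; near=> k; apply: filterS H => x /le_trans; apply.
rewrite ler_wpM2r//; near: k; exact: nbhs_pinfty_ge (num_real _).
Unshelve. all: by end_near. Qed.

Lemma fine_itv (R : realType) (a b : R) (c : \bar R) :
  (a%:E <= c)%E -> (c <= b%:E)%E -> a <= fine c <= b.
Proof. by case: c => //= c; rewrite !lee_fin => -> ->. Qed.

Lemma ln_sqrt_gaussian (R : realType) (nu : R) : 0 < nu ->
  2^-1 * ln (2 * pi * expR 1 * nu) = ln (Num.sqrt (2 * pi * nu)) + 2^-1.
Proof.
move=> nu0; have p0 : 0 < 2 * pi * nu :> R by rewrite !mulr_gt0 ?pi_gt0.
rewrite (_ : 2 * pi * expR 1 * nu = 2 * pi * nu * expR 1); last by ring.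
rewrite lnM ?posrE ?expR_gt0// expRK -{1}(sqr_sqrtr (ltW p0)) lnXn ?sqrtr_gt0//.
by set l := ln _; rewrite mulr2n; field.
Qed.

(** The whole error is on the converse side. Tails of variance [t] cost about
    [Num.sqrt (2 * pi * t) / A] in normalization and [nu / (2 * t)] in exponent; [t = tau ^+ 2] with
    [tau] the cube root of [nu] makes both of order [tau]. *)
Lemma capacity_small_noise (R : realType) (A nu : R) : 0 < A -> 0 < nu < 1 ->
  `|fine (capacity A nu) - (ln (2 * A) - 2^-1 * ln (2 * pi * expR 1 * nu))|
    <= (Num.sqrt (2 * pi) / A + 2^-1) * `|nu `^ 3^-1|.
Proof.
move=> A0 /andP[nu0 nu1]; set tau := nu `^ 3^-1.
have tau0 : 0 < tau by exact: powR_gt0.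
have tau3 : tau ^+ 3 = nu.
  by rewrite -powR_mulrn ?(ltW tau0)// -powRrM mulVf ?powRr1 ?ltW.
have tau1 : tau <= 1.
  by rewrite -(@ler_pXn2r _ 3)// ?nnegrE ?(ltW tau0)// tau3 expr1n ltW.
have nut : nu <= tau ^+ 2 by rewrite -tau3 exprS ler_piMl ?sqr_ge0.
have sq : Num.sqrt (2 * pi * tau ^+ 2) = Num.sqrt (2 * pi) * tau.
  by rewrite sqrtrM ?mulr_ge0 ?pi_ge0// sqrtr_sqr ger0_norm ?ltW.
have nutau : nu / tau ^+ 2 = tau by rewrite -tau3; field; rewrite gt_eqF.
have /fine_itv := capacity_ge_uniform A0 nu0.
move=> /(_ _ (capacity_le_gaussian_tails A0 nu0 nut)).
rewrite sq nutau (ger0_norm (ltW tau0)) ln_sqrt_gaussian//.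
set s := ln (Num.sqrt _); set k : R := Num.sqrt (2 * pi).
have k0 : 0 < k by rewrite sqrtr_gt0 !mulr_gt0 ?pi_gt0.
have A20 : 0 < 2 * A by lra.
have : ln (2 * A + 2 * (k * tau)) <= ln (2 * A) + k / A * tau.
  rewrite (_ : 2 * A + 2 * (k * tau) = 2 * A * (1 + k / A * tau)); last first.
    by field; rewrite gt_eqF.
  have kt0 : 0 < k / A * tau by rewrite mulr_gt0 ?divr_gt0.
  rewrite lnM ?posrE//; last by rewrite addr_gt0.
  by rewrite lerD2l; apply: le_ln1Dx; lra.
move=> Hln /andP[lo hi]; rewrite ger0_norm; last by lra.
by rewrite [leRHS]mulrDl; lra.
Qed.

Lemma capacity_small_noise_asymptotics (R : realType) (A : R) : 0 < A ->
  (fun nu : R => fine (capacity A nu))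
    = (fun nu : R => ln (2 * A) - 2^-1 * ln (2 * pi * expR 1 * nu))
    +O_ (0^'+) (fun nu : R => nu `^ 3^-1).
Proof.
move=> A0; apply: eqaddO_near; near=> nu; apply: capacity_small_noise => //.
by apply/andP; split; near: nu; [exact: nbhs_right_gt|exact: nbhs_right_lt].
Unshelve. all: by end_near. Qed.

(** * Large noise *)

(** In the tail of the series, k! is bounded below by (k - n)!, so that [|x| ^+ n] factors out of
    the series of [expR |x|]. *)
Lemma expR_taylor (R : realType) n (x : R) :
  `|expR x - \sum_(k < n) x ^+ k / k`!%:R| <= `|x| ^+ n * expR `|x|.
Proof.
pose S := series (exp_coeff x).
have Sn : S n = \sum_(k < n) x ^+ k / k`!%:R by rewrite /S /series/= big_mkord.
rewrite -Sn.
have cvS : S @ \oo --> expR x by exact: is_cvg_series_exp_coeff.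
have cvSn : (fun N => `|S N - S n|) @ \oo --> `|expR x - S n|.
  by apply: cvg_norm; apply: cvgB => //; exact: cvg_cst.
apply: (cvgr_to_le cvSn); near=> N.
have nN : (n <= N)%N by near: N; exact: nbhs_infty_ge.
rewrite /S sub_series_geq// (le_trans (ler_norm_sum _ _ _))//.
pose T := series (exp_coeff `|x|).
have TN : T (N - n)%N <= expR `|x|.
  apply: nondecreasing_cvgn_le; last exact: is_cvg_series_exp_coeff.
  apply/nondecreasing_seqP => m; rewrite /T /series/= big_nat_recr//= lerDl.
  by rewrite exp_coeff_ge0.
apply: (@le_trans _ _ (`|x| ^+ n * T (N - n)%N)); last by rewrite ler_wpM2l ?exprn_ge0.
rewrite /T /series/= mulr_sumr -{1}[n]add0n big_addn.
apply: ler_sum => k _; rewrite /exp_coeff/= normrM normrX normrV ?unitfE ?gt_eqF ?ltr0n ?fact_gt0//.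
rewrite [`|_%:R|]ger0_norm ?ler0n// mulrA -exprD (addnC n k) ler_wpM2l ?exprn_ge0//.
rewrite lef_pV2 ?posrE ?ltr0n ?fact_gt0// ler_nat.
by apply: leq_fact; rewrite leq_addr.
Unshelve. all: by end_near. Qed.

(* The fourth Taylor polynomial of [ln] at [1], expanded in powers of [c]. *)
Lemma ln_taylor4_le (R : realType) (c : R) : 1 <= c ->
  4 * c - 3 * c ^+ 2 + 4 / 3 * c ^+ 3 - c ^+ 4 / 4 - 25 / 12 <= ln c.
Proof.
move=> c1.
pose p : {poly R} := 4%:P * 'X - 3%:P * 'X^2 + (4 / 3)%:P * 'X^3
  - (1 / 4)%:P * 'X^4 - (25 / 12)%:P.
pose f (x : R) := ln x - p.[x].
have df (x : R) : 0 < x -> is_derive x 1 f (x^-1 - p^`().[x]).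
  by move=> x0; apply: is_deriveB; exact: is_derive1_ln.
have [||xi xiI fE] := @MVT_segment R f (fun x => x^-1 - p^`().[x]) 1 c c1.
- by move=> x; rewrite in_itv/= => /andP[x1 _]; apply: df; lra.
- apply: derivable_within_continuous => x; rewrite in_itv/= => /andP[x1 _].
  by apply: ex_derive; apply: df; lra.
move: xiI; rewrite in_itv/= => /andP[xi1 _].
have xi0 : 0 < xi by lra.
have df0 : 0 <= xi^-1 - p^`().[xi].
  (* The derivative of the polynomial is the geometric series of 1 / x in 1 - x cut after the cubic
     term, so a single signed term remains. *)
  rewrite (_ : _ - _ = (xi - 1) ^+ 4 / xi); last first.
    rewrite /p !(derivB, derivD, derivM, derivC, derivXn, derivX, deriv_exp) !hornerE/=; field; lra.
  by rewrite divr_ge0 ?(ltW xi0)// exprn_ge0//; lra.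
have : 0 <= f c - f 1 by rewrite fE mulr_ge0//; lra.
rewrite /f ln1 /p !hornerE/=; lra.
Qed.

(** One more Taylor term reverses the sign: the difference now has derivative (x - 1)^5 / x, again
    nonnegative for x at least 1. *)
Lemma ln_le_taylor5 (R : realType) (c : R) : 1 <= c ->
  ln c <= 4 * c - 3 * c ^+ 2 + 4 / 3 * c ^+ 3 - c ^+ 4 / 4 - 25 / 12
          + (c - 1) ^+ 5 / 5.
Proof.
move=> c1.
pose p : {poly R} := 4%:P * 'X - 3%:P * 'X^2 + (4 / 3)%:P * 'X^3
  - (1 / 4)%:P * 'X^4 - (25 / 12)%:P + (1 / 5)%:P * ('X - 1%:P) ^+ 5.
pose f (x : R) := p.[x] - ln x.
have df (x : R) : 0 < x -> is_derive x 1 f (p^`().[x] - x^-1).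
  by move=> x0; apply: is_deriveB; exact: is_derive1_ln.
have [||xi xiI fE] := @MVT_segment R f (fun x => p^`().[x] - x^-1) 1 c c1.
- by move=> x; rewrite in_itv/= => /andP[x1 _]; apply: df; lra.
- apply: derivable_within_continuous => x; rewrite in_itv/= => /andP[x1 _].
  by apply: ex_derive; apply: df; lra.
move: xiI; rewrite in_itv/= => /andP[xi1 _].
have xi0 : 0 < xi by lra.
have df0 : 0 <= p^`().[xi] - xi^-1.
  rewrite (_ : _ - _ = (xi - 1) ^+ 5 / xi); last first.
    rewrite /p !(derivB, derivD, derivM, derivC, derivXn, derivX, deriv_exp) !hornerE/=; field; lra.
  by rewrite divr_ge0 ?(ltW xi0)// exprn_ge0//; lra.
have : 0 <= f c - f 1 by rewrite fE mulr_ge0//; lra.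
rewrite /f ln1 /p !hornerE/=; lra.
Qed.

Lemma expR_mul_1B_le1 (R : realType) (t : R) : expR t * (1 - t) <= 1.
Proof.
have ee : expR t * expR (- t) = 1 by rewrite -expRD subrr expR0.
apply: (@le_trans _ _ (expR t * expR (- t))); last by rewrite ee.
by rewrite ler_wpM2l ?expR_ge0// expR_ge1Dx.
Qed.

(** The remainder is [lam ^+ 2] times a quantity free of [lam]. After averaging, a negative linear
    term therefore wins for small [lam]. *)
Lemma expR_le_quadratic (R : realType) (lam v : R) : 0 < lam <= 1 ->
  expR (lam * v) <= 1 + lam * v + 4 * lam ^+ 2 * expR (2 * `|v|).
Proof.
move=> /andP[lam0 lam1].
have h1 (t : R) : expR t <= 1 + t + t ^+ 2 * expR `|t|.
  have e1 := expR_ge1Dx t; have e2 := expR_ge1Dx (- t).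
  have et0 := expR_gt0 t.
  have h := expR_mul_1B_le1 t.
  have [t0|t0] := leP 0 t; first by rewrite ger0_norm//; nra.
  rewrite ltr0_norm//.
  have : 1 <= expR (- t) by lra.
  have : expR t <= 1 + t + t ^+ 2 by nra.
  have := sqr_ge0 t; nra.
(* From the square of [1 + |v| / 2 <= expR (|v| / 2)]. *)
have h2 : v ^+ 2 <= 4 * expR `|v|.
  have := expR_ge1Dx (`|v| / 2); have := normr_ge0 v; rewrite -(real_normK (num_real v)).
  have : expR `|v| = expR (`|v| / 2) ^+ 2 by rewrite -expRM_natl mulrC divfK.
  by move=> ->; nra.
apply: le_trans (h1 _) _; rewrite lerD2l exprMn normrM (gtr0_norm lam0).
have h3 : expR (lam * `|v|) <= expR `|v| by rewrite ler_expR ler_piMl.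
have h4 : expR (2 * `|v|) = expR `|v| * expR `|v| by rewrite -expRD; congr expR; ring.
rewrite h4 (_ : 4 * lam ^+ 2 * _ = lam ^+ 2 * (4 * expR `|v| * expR `|v|)); last by ring.
by rewrite -[leLHS]mulrA ler_wpM2l ?sqr_ge0// ler_pM ?sqr_ge0 ?expR_ge0.
Qed.

(** * Means under the noise law and a Chernoff bound uniform in the input *)

(** Integrability travels with the value, so means of linear combinations with coefficients of
    either sign are obtained by composing terms. *)
Definition has_mean (R : realType) (P : probability (borelR R) R) (W : borelR R -> R)
    (w : R) : Prop :=
  P.-integrable setT (EFin \o W) /\ (\int[P]_z (W z)%:E = w%:E)%E.

Lemma has_mean_cst (R : realType) (P : probability (borelR R) R) (c : R) :
  has_mean P (fun=> c) c.
Proof.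
split; first exact: finite_measure_integrable_cst.
transitivity (c%:E * P setT)%E; first exact: integral_cst.
by rewrite probability_setT mule1.
Qed.

Lemma has_meanD (R : realType) (P : probability (borelR R) R) W1 W2 (w1 w2 : R) :
  has_mean P W1 w1 -> has_mean P W2 w2 -> has_mean P (fun z => W1 z + W2 z) (w1 + w2).
Proof.
move=> [i1 e1] [i2 e2]; split; first exact: (integrableD measurableT i1 i2).
by rewrite -[LHS]/(\int[P]_z ((EFin \o W1) z + (EFin \o W2) z))%E integralD//= e1 e2.
Qed.

Lemma has_meanZ (R : realType) (P : probability (borelR R) R) (k : R) W (w : R) :
  has_mean P W w -> has_mean P (fun z => k * W z) (k * w).
Proof.
move=> [i e]; split; first exact: (integrableZl measurableT k i).
by rewrite -[LHS]/(\int[P]_z (k%:E * (EFin \o W) z))%E integralZl//= e.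
Qed.

Lemma has_mean_le (R : realType) (P : probability (borelR R) R) W1 W2 (w1 w2 : R) :
  has_mean P W1 w1 -> has_mean P W2 w2 -> (forall z, W1 z <= W2 z) -> w1 <= w2.
Proof.
move=> [i1 e1] [i2 e2] W12; rewrite -lee_fin -e1 -e2.
by apply: (le_integral measurableT i1 i2) => z _; rewrite lee_fin.
Qed.

Lemma has_mean_expR (R : realType) (nu b c : R) : 0 < nu ->
  has_mean (normal_prob 0 (Num.sqrt nu)) (fun z => expR (b * z + c))
    (expR (b ^+ 2 * nu / 2 + c)).
Proof.
move=> nu0; rewrite expRD mulrC.
rewrite (_ : (fun z => _) = fun z : borelR R => expR c * expR (b * z)); last first.
  by apply/funext => z; rewrite expRD mulrC.
apply: has_meanZ; split; last exact: normal_prob_mgf.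
apply/integrableP; split.
  apply/measurable_EFinP; apply: measurableT_comp; first exact: measurable_expR.
  exact: measurable_funM.
under eq_integral do rewrite /= ger0_norm ?expR_ge0//.
by rewrite normal_prob_mgf// ltry.
Qed.

(* Only the inequality [1 + h z <= exp (h z)] and the moment generating function
   are used, with [h] a small multiple of the mean. *)
Lemma has_mean_id (R : realType) (nu : R) : 0 < nu ->
  has_mean (normal_prob 0 (Num.sqrt nu)) id 0.
Proof.
move=> nu0; set P : probability (borelR R) R := normal_prob 0 (Num.sqrt nu).
have [i1 _] := has_mean_expR 1 0 nu0; have [i2 _] := has_mean_expR (-1) 0 nu0.
have iid : P.-integrable setT (EFin \o (id : borelR R -> R)).
  apply: (le_integrable measurableT _ _ (integrableD measurableT i1 i2)).
    exact/measurable_EFinP/measurable_id.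
  move=> z _ /=; rewrite lee_fin [leRHS]ger0_norm ?addr_ge0 ?expR_ge0//.
  rewrite !mulN1r !addr0 mul1r.
  have := expR_ge1Dx z; have := expR_ge1Dx (- z).
  have := expR_ge0 z; have := expR_ge0 (- z).
  by have [?|?] := ler0P z; lra.
pose m := fine (\int[P]_z z%:E)%E.
have mE : has_mean P id m.
  split => //; rewrite fineK//; exact: integrable_fin_num.
suff m0 : m = 0 by rewrite -m0.
apply/eqP; apply: contraT => mneq0.
have m20 : 0 < m ^+ 2 by rewrite exprn_even_gt0.
(* This [k] makes [p = k * m ^+ 2] and [q = k * nu] both less than 1. With slope [m * k] the
   inequality reads [1 + p <= expR (p * q / 2)], which fails for such [p > 0]. *)
pose k := (nu + m ^+ 2 + 1)^-1.
have k0 : 0 < k by rewrite invr_gt0; lra.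
have kE : k * (nu + m ^+ 2 + 1) = 1 by rewrite mulVf//; lra.
pose x := (m * k) ^+ 2 * nu / 2.
have hx : 1 + m * k * m <= expR x.
  rewrite -[x]addr0; apply: (has_mean_le (has_meanD (has_mean_cst P 1)
    (has_meanZ (m * k) mE)) (has_mean_expR (m * k) 0 nu0)) => z.
  by rewrite addr0 expR_ge1Dx.
have ex := expR_mul_1B_le1 x.
have kn : k * nu < 1 by nra.
have km : k * m ^+ 2 < 1 by nra.
have xE : x = (k * m ^+ 2) * (k * nu) / 2 by rewrite /x; ring.
have mkE : m * k * m = k * m ^+ 2 by ring.
rewrite mkE in hx.
set p := k * m ^+ 2 in km xE hx; set q := k * nu in kn xE.
have p0 : 0 < p by rewrite /p mulr_gt0.
have q0 : 0 < q by rewrite /q mulr_gt0.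
have x1 : x < 1 / 2 by nra.
have : (1 + p) * (1 - x) <= 1 by apply: le_trans ex; rewrite ler_wpM2r//; lra.
by rewrite xE; nra.
Qed.

(** The order of quantifiers matters: [lam] and [rho] are fixed before [V], so one pair serves every
    input. Linear growth of [V] gives a common bound [u] on the mean of [expR (2 * |V|)], and
    [expR_le_quadratic] then bounds the moment by [1 + lam * w + 4 * lam ^+ 2 * u]. *)
Lemma linear_chernoff (R : realType) (nu c k w : R) : 0 < nu -> w < 0 ->
  exists lam rho : R, [/\ 0 < lam, 0 <= rho < 1 &
    forall (V W : borelR R -> R) (w' : R), measurable_fun setT V ->
    (forall z, `|V z| <= c + k * `|z|) -> (forall z, V z <= W z) ->
    has_mean (normal_prob 0 (Num.sqrt nu)) W w' -> w' <= w ->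
    (\int[normal_prob 0 (Num.sqrt nu)]_z (expR (lam * V z))%:E <= rho%:E)%E].
Proof.
move=> nu0 w0.
set P : probability (borelR R) R := normal_prob 0 (Num.sqrt nu).
pose U (z : borelR R) : R := expR (2 * k * z + 2 * c) + expR (- (2 * k) * z + 2 * c).
have [u Uu] : exists u, has_mean P U u.
  by eexists; apply: has_meanD; exact: has_mean_expR.
have u0 : 0 <= u.
  by apply: (has_mean_le (has_mean_cst P 0) Uu) => z; rewrite addr_ge0 ?expR_ge0.
pose a := - w; have a0 : 0 < a by rewrite oppr_gt0.
(* [b] is a positive number below both 1 and [a]. Dividing by [8 * u + 1 + a] ensures
   [lam * a <= 1], whence [0 <= rho], and [8 * lam * u < a], whence [rho < 1]. *)
pose b := a / (1 + a); have b0 : 0 < b by rewrite divr_gt0//; lra.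
have bE : b * (1 + a) = a by rewrite /b mulfVK// gt_eqF//; lra.
have b1 : b <= 1 by nra.
have ba : b <= a by nra.
pose lam := b / (8 * u + 1 + a).
have lam0 : 0 < lam by rewrite divr_gt0//; lra.
have lamE : lam * (8 * u + 1 + a) = b by rewrite /lam mulfVK// gt_eqF//; lra.
have lamu0 : 0 <= lam * u by rewrite mulr_ge0// ltW.
have lama0 : 0 < lam * a by rewrite mulr_gt0.
have lam1 : lam <= 1 by nra.
have lama : lam * a <= 1 by nra.
have lamu : 8 * (lam * u) < a by nra.
exists lam, (1 + (lam * w + 4 * lam ^+ 2 * u)); split => //.
  have -> : lam * w + 4 * lam ^+ 2 * u = - (lam * a) + 4 * (lam * (lam * u)).
    by rewrite /a; ring.
  have lamlamu : 0 <= lam * (lam * u) by rewrite mulr_ge0// ltW.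
  have : lam * (8 * (lam * u)) < lam * a by rewrite ltr_pM2l.
  by move=> ?; apply/andP; split; lra.
move=> V W w' mV Vle VW Ww w'w.
have VU z : expR (2 * `|V z|) <= U z.
  apply: (@le_trans _ _ (expR (2 * (c + k * `|z|)))).
    by rewrite ler_expR ler_wpM2l.
  rewrite /U; have [z0|z0] := ler0P z.
    by rewrite ler_wpDl ?expR_ge0// ler_expR le_eqVlt; apply/orP; left; apply/eqP; ring.
  by rewrite ler_wpDr ?expR_ge0// ler_expR le_eqVlt; apply/orP; left; apply/eqP; ring.
have Rm := has_meanD (has_mean_cst P 1)
  (has_meanD (has_meanZ lam Ww) (has_meanZ (4 * lam ^+ 2) Uu)).
apply: (@le_trans _ _ (1 + (lam * w' + 4 * lam ^+ 2 * u))%:E); last first.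
  by rewrite lee_fin lerD2l lerD2r ler_wpM2l// ltW.
rewrite -Rm.2; apply: ge0_le_integral => //.
- apply/measurable_EFinP; apply: measurableT_comp; first exact: measurable_expR.
  exact: measurable_funM.
- by have /integrableP[] := Rm.1.
move=> z _; rewrite lee_fin.
have lamI : 0 < lam <= 1 by rewrite lam0.
apply: (le_trans (expR_le_quadratic (V z) lamI)).
rewrite -addrA lerD2l; apply: lerD; first by rewrite ler_wpM2l// ltW.
by rewrite ler_wpM2l// mulr_ge0 ?sqr_ge0.
Qed.

(* The mean of [cosh (j A (x + Z) / nu)], with [s = A^2 / nu] and [th = x / A]. *)
Definition cosh_mean (R : realType) (s th j : R) : R :=
  (expR (s * (j ^+ 2 / 2 + j * th)) + expR (s * (j ^+ 2 / 2 - j * th))) / 2.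

(* The exponents [j^2 / 2 + j th] with [j <= 5] and [|th| <= 1] are at most 20. *)
Definition taylor_const (R : realType) : R := 20 ^+ 5 * expR 20.

Lemma expR_taylor4 (R : realType) (s k : R) : 0 <= s <= 1 -> `|k| <= 20 ->
  `|expR (s * k) - (1 + s * k + (s * k) ^+ 2 / 2 + (s * k) ^+ 3 / 6
     + (s * k) ^+ 4 / 24)| <= taylor_const R * s ^+ 5.
Proof.
move=> /andP[s0 s1] k20; have := expR_taylor 5 (s * k).
rewrite !big_ord_recr big_ord0 /= add0r !factS fact0 expr0 expr1.
rewrite !muln1 !divr1 -[(3 * 2)%N]/6%N -[(4 * 6)%N]/24%N.
move=> /le_trans H; apply: H; rewrite normrM exprMn (ger0_norm s0) /taylor_const.
have sk : s * `|k| <= 20 by apply: le_trans k20; rewrite ler_piMl.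
rewrite -[leLHS]mulrA [leRHS]mulrC ler_wpM2l ?exprn_ge0//.
by rewrite ler_pM ?exprn_ge0 ?expR_ge0// ?ler_expR// lerXn2r ?nnegrE.
Qed.

(** The left side is the mean information of the input [th * A] once the logarithm is replaced by
    the bound of [ln_cosh_ge]. Its part up to order 4 in [s] is largest at [th = 1] and [th = -1],
    where [s <= 1 / 2] gives the comparison its sign. The 8 rounds up the sum of the absolute values
    of the four cosh coefficients. *)
Lemma bpsk_upper_bound (R : realType) (s th : R) : 0 <= s <= 1 / 2 -> `|th| <= 1 ->
  th ^+ 2 * s / 2 + s / 2 - (- 353 / 96 + 5 * cosh_mean s th 1
     - 13 / 8 * cosh_mean s th 2 + 1 / 3 * cosh_mean s th 3
     - 1 / 32 * cosh_mean s th 4)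
  <= s / 2 - s ^+ 2 / 4 + s ^+ 3 / 6 - 5 * s ^+ 4 / 24
     + 8 * (taylor_const R * s ^+ 5).
Proof.
move=> /andP[s0 s1] th1; have s01 : 0 <= s <= 1 by rewrite s0/=; lra.
have K0 : 0 <= taylor_const R * s ^+ 5.
  by rewrite !mulr_ge0 ?exprn_ge0 ?expR_ge0.
have /andP[th1' th1''] : -1 <= th <= 1 by rewrite -ler_norml.
(* The order-four main term at [th = 1] minus the one at [th]. *)
have M : 0 <= (1 - th ^+ 2) * (s * (1 / 2 - s / 2 + s ^+ 2 / 2 - s ^+ 3))
     + (1 - th ^+ 4) * (s ^+ 4 / 12).
  have t2 : th ^+ 2 <= 1 by rewrite -(real_normK (num_real th)) expr_le1.
  have t4 : th ^+ 4 <= 1 by rewrite (exprM th 2 2) expr_le1 ?sqr_ge0.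
  have s3 : s ^+ 3 <= 1 / 8.
    rewrite (_ : 1 / 8 = (1 / 2) ^+ 3); last by field.
    by rewrite lerXn2r ?nnegrE//; lra.
  rewrite addr_ge0// mulr_ge0 ?subr_ge0 ?divr_ge0 ?exprn_ge0//.
  by rewrite mulr_ge0//; have := sqr_ge0 s; lra.
have B (j : R) : 0 <= j <= 4 ->
    (`|j ^+ 2 / 2 + j * th| <= 20) /\ (`|j ^+ 2 / 2 - j * th| <= 20).
  move=> /andP[j0 j4]; have jth : - j <= j * th <= j by apply/andP; split; nra.
  have : 0 <= j ^+ 2 <= 16 by apply/andP; split; nra.
  by move: jth => /andP[? ?] /andP[? ?]; rewrite !ler_norml; split; apply/andP; split; lra.
have T (j : R) (hj : 0 <= j <= 4) :=
  (expR_taylor4 s01 (B j hj).1, expR_taylor4 s01 (B j hj).2).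
have := T 1 ltac:(lra); have := T 2 ltac:(lra); have := T 3 ltac:(lra); have := T 4 ltac:(lra).
rewrite !ler_norml => -[/andP[a1 a2] /andP[a3 a4]] [/andP[b1 b2] /andP[b3 b4]].
move=> [/andP[c1 c2] /andP[c3 c4]] [/andP[d1 d2] /andP[d3 d4]].
rewrite /cosh_mean; clear T B.
move: a1 a2 a3 a4 b1 b2 b3 b4 c1 c2 c3 c4 d1 d2 d3 d4 K0.
set K := taylor_const R * s ^+ 5.
set e1 := expR _; set e2 := expR _; set e3 := expR _; set e4 := expR _.
set e5 := expR _; set e6 := expR _; set e7 := expR _; set e8 := expR _.
move=> *; lra.
Qed.

(** Only the two input points occur here, and [cosh_mean] is even in [th], so everything reduces to
    [th = 1]. The coefficients are those of [ln_cosh_le]; 12 rounds up the sum of their absolute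
    values, the constant term excluded. *)
Lemma bpsk_lower_bound (R : realType) (s th : R) : 0 <= s <= 1 -> th = 1 \/ th = -1 ->
  s / 2 - s ^+ 2 / 4 + s ^+ 3 / 6 - 5 * s ^+ 4 / 24
     - 12 * (taylor_const R * s ^+ 5) <=
  th ^+ 2 * s / 2 + s / 2 - (- 2521 / 480 + 61 / 8 * cosh_mean s th 1
     - 25 / 8 * cosh_mean s th 2 + 43 / 48 * cosh_mean s th 3
     - 5 / 32 * cosh_mean s th 4 + 1 / 80 * cosh_mean s th 5).
Proof.
move=> s01 th1.
have Hth : th ^+ 2 = 1 by case: th1 => ->; rewrite ?expr1n// sqrrN expr1n.
have E j : cosh_mean s th j = cosh_mean s 1 j.
  rewrite /cosh_mean; case: th1 => -> //; rewrite mulrN1 mulr1 opprK addrC//.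
rewrite Hth !E /cosh_mean.
have K0 : 0 <= taylor_const R * s ^+ 5.
  by case/andP: s01 => s0 _; rewrite !mulr_ge0 ?exprn_ge0 ?expR_ge0.
have B (k : R) : -20 <= k <= 20 -> `|k| <= 20 by rewrite ler_norml.
have T (k : R) (hk : -20 <= k <= 20) := expR_taylor4 s01 (B k hk).
have := T (1 ^+ 2 / 2 + 1 * 1) ltac:(apply/andP; split; lra).
have := T (1 ^+ 2 / 2 - 1 * 1) ltac:(apply/andP; split; lra).
have := T (2 ^+ 2 / 2 + 2 * 1) ltac:(apply/andP; split; lra).
have := T (2 ^+ 2 / 2 - 2 * 1) ltac:(apply/andP; split; lra).
have := T (3 ^+ 2 / 2 + 3 * 1) ltac:(apply/andP; split; lra).
have := T (3 ^+ 2 / 2 - 3 * 1) ltac:(apply/andP; split; lra).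
have := T (4 ^+ 2 / 2 + 4 * 1) ltac:(apply/andP; split; lra).
have := T (4 ^+ 2 / 2 - 4 * 1) ltac:(apply/andP; split; lra).
have := T (5 ^+ 2 / 2 + 5 * 1) ltac:(apply/andP; split; lra).
have := T (5 ^+ 2 / 2 - 5 * 1) ltac:(apply/andP; split; lra).
rewrite !ler_norml => /andP[? ?] /andP[? ?] /andP[? ?] /andP[? ?] /andP[? ?].
move=> /andP[? ?] /andP[? ?] /andP[? ?] /andP[? ?] /andP[? ?].
clear T B E; lra.
Qed.

(** * Antipodal inputs *)

Definition cosh_at (R : realType) (u : R) : R := (expR u + expR (- u)) / 2.

Lemma cosh_at_ge1 (R : realType) (u : R) : 1 <= cosh_at u.
Proof. by rewrite /cosh_at; have := expR_ge1Dx u; have := expR_ge1Dx (- u); lra. Qed.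

(** Makes the information density grow at most linearly in the noise, as [linear_chernoff]
    requires. *)
Lemma ln_cosh_at_itv (R : realType) (u : R) : 0 <= ln (cosh_at u) <= `|u|.
Proof.
have c1 := cosh_at_ge1 u; rewrite ln_ge0//= -[leRHS](expRK `|u|) ler_ln ?posrE ?expR_gt0//.
  rewrite /cosh_at; have : expR u <= expR `|u| by rewrite ler_expR ler_norm.
  have : expR (- u) <= expR `|u| by rewrite ler_expR -normrN ler_norm.
  by lra.
by apply: lt_le_trans c1.
Qed.

Lemma cosh_at_natmul (R : realType) (n : nat) (u : R) :
  cosh_at (n%:R * u) = (expR u ^+ n + (expR u)^-1 ^+ n) / 2.
Proof. by rewrite /cosh_at -mulrN !expRM_natl expRN. Qed.

(* Powers of [cosh u] in [ln_taylor4_le] and [ln_le_taylor5] are linearized into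
   [cosh (j u)], whose Gaussian means are explicit. *)
Lemma ln_cosh_ge (R : realType) (u : R) :
  - 353 / 96 + 5 * cosh_at (1 * u) - 13 / 8 * cosh_at (2 * u)
    + 1 / 3 * cosh_at (3 * u) - 1 / 32 * cosh_at (4 * u) <= ln (cosh_at u).
Proof.
apply: le_trans (ln_taylor4_le (cosh_at_ge1 u)).
rewrite mul1r !cosh_at_natmul /cosh_at !expRN; set E := expR u.
have E0 : E != 0 by rewrite gt_eqF ?expR_gt0.
by rewrite le_eqVlt; apply/orP; left; apply/eqP; field.
Qed.

Lemma ln_cosh_le (R : realType) (u : R) :
  ln (cosh_at u) <= - 2521 / 480 + 61 / 8 * cosh_at (1 * u)
    - 25 / 8 * cosh_at (2 * u) + 43 / 48 * cosh_at (3 * u)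
    - 5 / 32 * cosh_at (4 * u) + 1 / 80 * cosh_at (5 * u).
Proof.
apply: le_trans (ln_le_taylor5 (cosh_at_ge1 u)) _.
rewrite mul1r !cosh_at_natmul /cosh_at !expRN; set E := expR u.
have E0 : E != 0 by rewrite gt_eqF ?expR_gt0.
by rewrite le_eqVlt; apply/orP; left; apply/eqP; field.
Qed.

Lemma has_mean_cosh (R : realType) (A nu th j : R) : 0 < nu ->
  has_mean (normal_prob 0 (Num.sqrt nu))
    (fun z => cosh_at (j * (A * (th * A + z) / nu))) (cosh_mean (A ^+ 2 / nu) th j).
Proof.
move=> nu0.
have := has_meanZ 2^-1 (has_meanD
  (has_mean_expR (j * A / nu) (j * th * (A ^+ 2 / nu)) nu0)
  (has_mean_expR (- (j * A / nu)) (- (j * th * (A ^+ 2 / nu))) nu0)).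
congr (has_mean _ _ _).
  apply/funext => z; rewrite /cosh_at mulrC; congr ((expR _ + expR _) / 2);
  by field; rewrite gt_eqF.
rewrite /cosh_mean mulrC; congr ((expR _ + expR _) / 2); by field; rewrite gt_eqF.
Qed.

(* The density, relative to the noise law, of the output of the input uniform on {-A, A}. *)
Definition bpsk_output (R : realType) (A nu : R) (y : borelR R) : R :=
  expR (- (A ^+ 2 / nu / 2)) * cosh_at (A * y / nu).

Lemma bpsk_output_gt0 (R : realType) (A nu : R) y : 0 < bpsk_output A nu y.
Proof. by rewrite mulr_gt0 ?expR_gt0// (lt_le_trans _ (cosh_at_ge1 _)). Qed.

Lemma measurable_bpsk_output (R : realType) (A nu : R) :
  measurable_fun setT (@bpsk_output R A nu).
Proof.
apply: measurable_funM => //; apply: measurable_funM => //.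
have m1 : measurable_fun setT (fun y : borelR R => A * y / nu).
  by apply: measurable_funM => //; exact: measurable_funM.
apply: measurable_funD; apply: measurableT_comp; try exact: measurable_expR; first by [].
exact: measurableT_comp m1.
Qed.

Lemma bpsk_information (R : realType) (A nu th z : R) : 0 < nu ->
  gaussian_information nu (@bpsk_output R A nu) (th * A) (th * A + z) =
  th ^+ 2 * (A ^+ 2 / nu) / 2 + A ^+ 2 / nu / 2 + th * (A / nu) * z
  - ln (cosh_at (A * (th * A + z) / nu)).
Proof.
move=> nu0; rewrite /gaussian_information /bpsk_output lnM ?posrE ?expR_gt0//.
  by rewrite expRK; field; rewrite gt_eqF.
exact: lt_le_trans (cosh_at_ge1 _).
Qed.

Lemma bpsk_information_bound (R : realType) (A nu gam th z : R) : 0 < nu -> 0 < A ->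
  `|th| <= 1 ->
  `|gaussian_information nu (@bpsk_output R A nu) (th * A) (th * A + z) - gam|
  <= 2 * (A ^+ 2 / nu) + `|gam| + 2 * (A / nu) * `|z|.
Proof.
move=> nu0 A0 th1; rewrite bpsk_information//.
have s0 : 0 < A ^+ 2 / nu by rewrite divr_gt0 ?exprn_gt0.
have r0 : 0 < A / nu by rewrite divr_gt0.
have := ln_cosh_at_itv (A * (th * A + z) / nu).
have uE : `|A * (th * A + z) / nu| <= A ^+ 2 / nu + A / nu * `|z|.
  rewrite (_ : A * (th * A + z) / nu = th * (A ^+ 2 / nu) + A / nu * z); last first.
    by field; rewrite gt_eqF.
  apply: le_trans (ler_normD _ _) _.
  rewrite (normrM th) (normrM (A / nu)) (gtr0_norm s0) (gtr0_norm r0).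
  by rewrite lerD2r ler_piMl// ltW.
move=> /andP[l0 /le_trans /(_ uE) l1].
have thz : `|th * (A / nu) * z| <= A / nu * `|z|.
  by rewrite (normrM (th * (A / nu))) (normrM th) (gtr0_norm r0) -mulrA ler_piMl// mulr_ge0// ltW.
have th2 : 0 <= th ^+ 2 * (A ^+ 2 / nu) / 2 <= A ^+ 2 / nu / 2.
  have t2 : th ^+ 2 <= 1 by rewrite -(real_normK (num_real th)) expr_le1.
  have tt0 : 0 <= th ^+ 2 * (A ^+ 2 / nu) by rewrite mulr_ge0 ?sqr_ge0 ?(ltW s0).
  have tt1 : th ^+ 2 * (A ^+ 2 / nu) <= A ^+ 2 / nu by rewrite ler_piMl// ltW.
  by apply/andP; split; lra.
move: thz th2 l0 l1; rewrite !ler_norml => /andP[? ?] /andP[? ?] ? ?.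
have := ler_norm gam; have := ler_norm (- gam); rewrite normrN => ? ?.
by apply/andP; split; lra.
Qed.

Lemma measurable_bpsk_information (R : realType) (A nu gam x : R) : 0 < nu ->
  measurable_fun setT (fun z : borelR R =>
    gaussian_information nu (@bpsk_output R A nu) x (x + z) - gam).
Proof.
move=> nu0; apply: measurable_funB => //.
have [_ _ mi _] := gaussian_information_density nu0 (measurable_bpsk_output A nu)
  (@bpsk_output_gt0 R A nu).
have madd : measurable_fun setT ((fun z => x + z) : borelR R -> borelR R).
  exact: measurable_funD.
exact: measurableT_comp (mi x) madd.
Qed.

Lemma capacity_le_bpsk (R : realType) (A nu : R) : 0 < A -> 0 < nu ->
  let s := A ^+ 2 / nu in s <= 1 / 2 ->
  (capacity A nu <= (s / 2 - s ^+ 2 / 4 + s ^+ 3 / 6 - 5 * s ^+ 4 / 24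
     + 8 * (taylor_const R * s ^+ 5))%:E)%E.
Proof.
move=> A0 nu0 s s2; apply: capacity_le => r gam ar Dgam.
have s0 : 0 < s by rewrite divr_gt0 ?exprn_gt0.
have w0 := Dgam; rewrite -subr_lt0 in w0.
have [lam [rho [lam0 rho1 chern]]] :=
  linear_chernoff (2 * s + `|gam|) (2 * (A / nu)) nu0 w0.
(* The mean of cosh (A Z / nu) is [expR (s / 2)], which the prefactor of [bpsk_output] cancels. *)
have q1 : (\int[normal_prob 0 (Num.sqrt nu)]_y (bpsk_output A nu y)%:E <= 1)%E.
  have [_] := has_meanZ (expR (- (A ^+ 2 / nu / 2))) (has_mean_cosh A 0 1 nu0).
  rewrite /cosh_mean (_ : expR _ * _ = 1).
    move=> H; rewrite -[leRHS]H le_eqVlt; apply/orP; left; apply/eqP.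
    by apply: eq_integral => y _; rewrite /bpsk_output mul0r add0r mul1r.
  have half (e : R) : (e + e) / 2 = e by field.
  by rewrite mulr0 addr0 subr0 half expr1n mul1r -expRD addNr expR0.
apply: (achievable_le (gaussian_information_density nu0 (measurable_bpsk_output A nu)
  (@bpsk_output_gt0 R A nu)) q1 lam0 rho1 _ ar) => x xA.
pose th := x / A; have xE : x = th * A by rewrite /th divfK// gt_eqF.
have th1 : `|th| <= 1 by rewrite normrM normfV (gtr0_norm A0) ler_pdivrMr// mul1r.
rewrite xE.
(* The information density minus [gam], with the logarithm replaced by the lower bound of
   [ln_cosh_ge]: a majorant whose mean is explicit. *)
have Wm := has_meanD (has_mean_cst (normal_prob 0 (Num.sqrt nu))
     (th ^+ 2 * s / 2 + s / 2 + 353 / 96 - gam))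
  (has_meanD (has_meanZ (th * (A / nu)) (has_mean_id nu0))
  (has_meanD (has_meanZ (- 5) (has_mean_cosh A th 1 nu0))
  (has_meanD (has_meanZ (13 / 8) (has_mean_cosh A th 2 nu0))
  (has_meanD (has_meanZ (- (1 / 3)) (has_mean_cosh A th 3 nu0))
             (has_meanZ (1 / 32) (has_mean_cosh A th 4 nu0)))))).
apply: (chern _ _ _ _ _ _ Wm).
- exact: measurable_bpsk_information.
- by move=> z; exact: bpsk_information_bound.
- move=> z; rewrite bpsk_information//= -/s.
  by have := ln_cosh_ge (A * (th * A + z) / nu); lra.
have s02 : 0 <= s <= 1 / 2 by rewrite ltW.
by have := bpsk_upper_bound s02 th1; rewrite -/s; lra.
Qed.

(** [bpsk_output] is half the sum of the Cameron-Martin factors of [A] and [- A], so the right side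
    is the average of the two shifted integrals and the smaller one qualifies. *)
Lemma exists_input_le_bpsk (R : realType) (A nu : R) (F : borelR R -> \bar R) :
  0 < nu -> measurable_fun setT F -> (forall y, 0 <= F y)%E ->
  exists2 x, [set A; - A]%classic x &
    (\int[normal_prob 0 (Num.sqrt nu)]_z F (x + z)%R <=
     \int[normal_prob 0 (Num.sqrt nu)]_y (F y * (bpsk_output A nu y)%:E))%E.
Proof.
move=> nu0 mF F0; set P := normal_prob 0 (Num.sqrt nu).
pose L (x : R) (y : borelR R) : R := expR ((x * y - x ^+ 2 / 2) / nu).
have mL x : measurable_fun setT (L x).
  apply: measurableT_comp; first exact: measurable_expR.
  by apply: measurable_funM => //; apply: measurable_funB => //; exact: measurable_funM.
have mFL x : measurable_fun setT (fun y => F y * (L x y)%:E)%E.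
  by apply: emeasurable_funM => //; exact/measurable_EFinP.
have FL0 x y : (0 <= F y * (L x y)%:E)%E by rewrite mule_ge0// lee_fin expR_ge0.
have sh x : (\int[P]_z F (x + z)%R = \int[P]_y (F y * (L x y)%:E))%E.
  exact: normal_prob_shift.
have qE y : (F y * (bpsk_output A nu y)%:E =
    (2^-1)%:E * (F y * (L A y)%:E + F y * (L (- A) y)%:E))%E.
  rewrite -ge0_muleDr ?lee_fin ?expR_ge0// muleCA -EFinD -EFinM; congr (_ * _%:E)%E.
  rewrite /bpsk_output /cosh_at mulrA mulrC mulrDr -!expRD.
  by congr (_ * (expR _ + expR _)); field; rewrite gt_eqF.
under eq_integral do rewrite qE.
rewrite ge0_integralZl//; last 2 first.
- exact: emeasurable_funD.
- by move=> y _; exact: adde_ge0.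
rewrite ge0_integralD// -!sh.
set a := (\int[P]_z F (A + z)%R)%E; set b := (\int[P]_z F (- A + z)%R)%E.
have half (c : \bar R) : ((2^-1)%:E * (c + c) = c)%E.
  by rewrite -mule2n -mule_natl muleA -EFinM mulVf// mul1e.
have [ab|/ltW ba] := leP a b.
  exists A; first by left.
  by rewrite -/a -[leLHS]half lee_wpmul2l ?lee_fin ?invr_ge0// leeD2l.
exists (- A); first by right.
by rewrite -/b -[leLHS]half lee_wpmul2l ?lee_fin ?invr_ge0// leeD2r.
Qed.

Lemma capacity_ge_bpsk (R : realType) (A nu : R) : 0 < A -> 0 < nu ->
  let s := A ^+ 2 / nu in s <= 1 ->
  ((s / 2 - s ^+ 2 / 4 + s ^+ 3 / 6 - 5 * s ^+ 4 / 24
     - 12 * (taylor_const R * s ^+ 5))%:E <= capacity A nu)%E.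
Proof.
move=> A0 nu0 s s1; apply: capacity_ge; first exact: ltW.
move=> r gam r0gam gamD.
have s0 : 0 < s by rewrite divr_gt0 ?exprn_gt0.
have w0 := gamD; rewrite -subr_lt0 in w0.
have [lam [rho [lam0 rho1 chern]]] :=
  linear_chernoff (2 * s + `|gam|) (2 * (A / nu)) nu0 w0.
apply: (achievable_of_information_density (S := [set A; - A]%classic)
  (gaussian_information_density nu0 (measurable_bpsk_output A nu)
  (@bpsk_output_gt0 R A nu)) _ _ lam0 rho1 _ r0gam).
- by move=> x [|] -> /=; rewrite ?normrN ger0_norm// ltW.
- by move=> F mF F0; exact: exists_input_le_bpsk.
move=> x Sx.
have [th th1 ->] : exists2 th : R, th = 1 \/ th = -1 & x = th * A.
  by case: Sx => ->; [exists 1; [left|rewrite mul1r]|exists (-1); [right|rewrite mulN1r]].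
have nth1 : `|th| <= 1 by case: th1 => ->; rewrite ?normrN normr1.
(* Now [gam] minus the information density has to be majorized, so the logarithm enters with a plus
   sign and [ln_cosh_le] takes over. *)
have Wm := has_meanD (has_mean_cst (normal_prob 0 (Num.sqrt nu))
     (gam - th ^+ 2 * s / 2 - s / 2 - 2521 / 480))
  (has_meanD (has_meanZ (- (th * (A / nu))) (has_mean_id nu0))
  (has_meanD (has_meanZ (61 / 8) (has_mean_cosh A th 1 nu0))
  (has_meanD (has_meanZ (- (25 / 8)) (has_mean_cosh A th 2 nu0))
  (has_meanD (has_meanZ (43 / 48) (has_mean_cosh A th 3 nu0))
  (has_meanD (has_meanZ (- (5 / 32)) (has_mean_cosh A th 4 nu0))
             (has_meanZ (1 / 80) (has_mean_cosh A th 5 nu0))))))).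
apply: (chern _ _ _ _ _ _ Wm).
- rewrite (_ : (fun z => _) = (fun z : borelR R => -
    (gaussian_information nu (@bpsk_output R A nu) (th * A) (th * A + z) - gam))).
    exact: measurableT_comp (measurable_bpsk_information A gam (th * A) nu0).
  by apply/funext => z; exact/esym/opprB.
- by move=> z; rewrite distrC; exact: bpsk_information_bound.
- move=> z; rewrite bpsk_information//= -/s.
  by have := ln_cosh_le (A * (th * A + z) / nu); lra.
have s01 : 0 <= s <= 1 by rewrite ltW.
by have := bpsk_lower_bound s01 th1; rewrite -/s; lra.
Qed.

(** The noise threshold ensures [s <= 1 / 2] for the upper bound, and 12 is the larger of the two
    error constants. *)
Lemma capacity_large_noise (R : realType) (A nu : R) : 0 < A -> 2 * A ^+ 2 < nu ->
  let alpha := A / Num.sqrt nu in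
  `|fine (capacity A nu) - (alpha ^+ 2 / 2 - alpha ^+ 4 / 4
      + alpha ^+ 6 / 6 - 5 * alpha ^+ 8 / 24)|
    <= 12 * taylor_const R * `|alpha ^+ 10|.
Proof.
move=> A0 nuA; cbv zeta; set alpha := A / Num.sqrt nu.
have nu0 : 0 < nu by apply: lt_trans nuA; rewrite mulr_gt0 ?exprn_gt0.
have sE : alpha ^+ 2 = A ^+ 2 / nu by rewrite /alpha exprMn exprVn sqr_sqrtr// ltW.
rewrite (exprM alpha 2 2) (exprM alpha 2 3) (exprM alpha 2 4) (exprM alpha 2 5) sE.
have s2 : A ^+ 2 / nu <= 1 / 2 by rewrite ler_pdivrMr//; lra.
have s1 : A ^+ 2 / nu <= 1 by lra.
have /fine_itv := capacity_ge_bpsk A0 nu0 s1.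
move=> /(_ _ (capacity_le_bpsk A0 nu0 s2)).
have s0 : 0 < A ^+ 2 / nu by rewrite divr_gt0 ?exprn_gt0.
have K0 : 0 <= taylor_const R * (A ^+ 2 / nu) ^+ 5.
  have T0 : 0 <= taylor_const R by rewrite mulr_ge0 ?exprn_ge0 ?expR_ge0.
  exact: mulr_ge0 T0 (exprn_ge0 5 (ltW s0)).
rewrite (ger0_norm (exprn_ge0 5 (ltW s0))) -[12 * _ * _]mulrA.
move: K0; set K : R := taylor_const R * _; set x : R := fine _.
move=> K0 /andP[lo hi]; rewrite ler_norml; apply/andP; split; lra.
Qed.

Unset Implicit Arguments.

(* fine maps infinite values to 0, which neither expansion allows: each one
   implies that the capacity is finite near the corresponding limit. *)
Theorem theorem7p6 (R : realType) (A : R) (hA : 0 < A) :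
  (fun nu : R => fine (capacity A nu))
    = (fun nu : R => ln (2 * A) - 2^-1 * ln (2 * pi * expR 1 * nu))
    +O_ (0^'+) (fun nu : R => nu `^ 3^-1)
  /\
  let alpha (nu : R) := A / Num.sqrt nu in
  (fun nu : R => fine (capacity A nu))
    = (fun nu : R => alpha nu ^+ 2 / 2 - alpha nu ^+ 4 / 4
                     + alpha nu ^+ 6 / 6 - 5 * alpha nu ^+ 8 / 24)
    +O_ (+oo) (fun nu : R => alpha nu ^+ 10).
Proof.
split; first exact: capacity_small_noise_asymptotics.
move=> alpha; apply: eqaddO_near; near=> nu; apply: capacity_large_noise => //.
by near: nu; exact: nbhs_pinfty_gt (num_real _).
Unshelve. all: by end_near. Qed.
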